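(* There is an absolute constant $C>0$ such that the following holds. Let $\Gamma$ be an extension parallel congestion game with $n$ players, common strategy set $\mathcal{P}=\{p_1,\dots,p_q\}$ and non-negative non-decreasing cost functions, let $T\geq 0$ and $\epsilon\in(0,1)$. Consider the procedure: start from an arbitrary base $B_0$ of the $n$-uniform matroid on $E'=\{(p,j):p\in\mathcal{P},1\le j\le n\}$ (i.e., any $n$-element subset of $E'$), run the base-exchange Markov chain with weights $w_\Pi$ for $t$ steps, obtaining $B_t$; let $\alpha=\alpha(B_t)$; output a strategy profile $s$ chosen uniformly at random from $\mathcal{S}(\alpha)$. If $t\geq C\,n\log(n/\epsilon)$, then the distribution $\bar\pi$ of the output satisfies $d_{TV}(\bar\pi,\pi)\leq\epsilon$, where $\pi$ is the Gibbs distribution of $\Gamma$ at temperature $T$.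
   Context: EP congestion game: player set $N=[n]$; resources are the arcs of an extension parallel network (defined recursively: a single arc $(o,d)$; parallel composition of two EP networks, identifying sources and targets; series composition of a single arc with an EP network); every player's strategies are the $o,d$-paths $\mathcal{P}$; arc $e$ has cost $c_e:\mathbb{Z}_{\ge0}\to\mathbb{Q}$. $\ell_e(s)=|\{i:e\in s_i\}|$; Rosenthal's potential $\Phi(s)=\sum_e\sum_{k=1}^{\ell_e(s)}c_e(k)$. Gibbs distribution on $\mathcal{P}^n$: $\pi(s)=e^{-T\Phi(s)}/\sum_{t\in\mathcal{P}^n}e^{-T\Phi(t)}$. Strategy load profile $z(s)_p=|\{i:s_i=p\}|$, $\mathcal{S}(\alpha)=\{s:z(s)=\alpha\}$, $\Phi(\alpha)=\Phi(s)$ for $s\in\mathcal{S}(\alpha)$. For $B\subseteq E'$, $\alpha(B)_p=|\{j:(p,j)\in B\}|$. Weights: $w_\Pi(B)=\binom{n}{\alpha(B)}^{-1}\frac{n!}{\alpha(B)!}e^{-T\Phi(\alpha(B))}$ where $\binom{n}{\alpha}=\prod_p\binom{n}{\alpha_p}$, $\alpha!=\prod_p\alpha_p!$. Base-exchange Markov chain: from base $B$, choose $e\in B$ uniformly at random, then move to a base $B'\supseteq B\setminus\{e\}$ with probability proportional to $w_\Pi(B')$. $d_{TV}(\mu,\nu)=\frac12\sum_x|\mu(x)-\nu(x)|$. *)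

(* Defs.v *)
From HB Require Import structures.
From mathcomp Require Import all_boot all_order all_algebra.
From mathcomp Require Import reals.
From mathcomp Require Import sequences exp.
Set Implicit Arguments. Unset Strict Implicit. Unset Printing Implicit Defensive.
Import Order.TTheory GRing.Theory Num.Theory.
Local Open Scope ring_scope.

(* EArc       : a single arc (o,d)
   EPar g1 g2 : parallel composition (sources and targets identified)
   ESer g     : series composition of a single new arc (o,v) with g (from v to d) *)
Inductive ep : Type := EArc | EPar of ep & ep | ESer of ep.

Fixpoint ep_arc (g : ep) : finType :=
  match g with
  | EArc => unit
  | EPar a b => (ep_arc a + ep_arc b)%type
  | ESer b => option (ep_arc b)
  end.

Fixpoint ep_path (g : ep) : finType :=
  match g with
  | EArc => unit
  | EPar a b => (ep_path a + ep_path b)%type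
  | ESer b => ep_path b
  end.

Fixpoint path_arcs (g : ep) : ep_path g -> {set ep_arc g} :=
  match g return ep_path g -> {set ep_arc g} with
  | EArc => fun _ => setT
  | EPar a b => fun p =>
      match p with
      | inl q => [set inl x | x in @path_arcs a q]
      | inr q => [set inr x | x in @path_arcs b q]
      end
  | ESer b => fun p => None |: [set Some x | x in @path_arcs b p]
  end.

Section Game.
Variable R : realType.
Variable g : ep.
Variable n : nat.
Variable c : ep_arc g -> nat -> rat.
Variable T : R.

Local Notation P := (ep_path g).
Definition profile := {ffun 'I_n -> P}.

Definition load (s : profile) (e : ep_arc g) : nat :=
  #|[set i : 'I_n | e \in path_arcs (s i)]|.

Definition rosenthal (s : profile) : rat :=
  \sum_(e : ep_arc g) \sum_(1 <= k < (load s e).+1) c e k.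

Definition gibbs (s : profile) : R :=
  expR (- T * ratr (rosenthal s)) /
  \sum_(t : profile) expR (- T * ratr (rosenthal t)).

Definition zload (s : profile) : {ffun P -> nat} :=
  [ffun p => #|[set i : 'I_n | s i == p]|].

Definition Sset (alpha : {ffun P -> nat}) : {set profile} :=
  [set s | zload s == alpha].

(* Phi(alpha) := Phi(s) for some s in S(alpha) (well defined; 0 if S(alpha) is empty) *)
Definition PhiA (alpha : {ffun P -> nat}) : rat :=
  if [pick s in Sset alpha] is Some s then rosenthal s else 0.

Definition E' := (P * 'I_n)%type.

Definition alphaB (B : {set E'}) : {ffun P -> nat} :=
  [ffun p => #|[set j : 'I_n | (p, j) \in B]|].

Definition is_base (B : {set E'}) : bool := #|B| == n.

Definition wPi (B : {set E'}) : R :=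
  let a := alphaB B in
  ((\prod_(p : P) 'C(n, a p))%:R)^-1 * (n`!)%:R / ((\prod_(p : P) (a p)`!)%:R)
  * expR (- T * ratr (PhiA a)).

Definition bx_kernel (B B' : {set E'}) : R :=
  \sum_(e in B) (#|B|%:R)^-1 *
    (if (B :\ e \subset B') && is_base B' then
       wPi B' / \sum_(B'' : {set E'} | (B :\ e \subset B'') && is_base B'') wPi B''
     else 0).

Fixpoint bx_dist (B0 : {set E'}) (t : nat) (B' : {set E'}) : R :=
  match t with
  | 0 => if B' == B0 then 1 else 0
  | t'.+1 => \sum_(B : {set E'}) bx_dist B0 t' B * bx_kernel B B'
  end.

Definition output_dist (B0 : {set E'}) (t : nat) (s : profile) : R :=
  \sum_(B : {set E'}) bx_dist B0 t B *
    (if s \in Sset (alphaB B) then (#|Sset (alphaB B)|%:R)^-1 else 0).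

End Game.

Definition dTV (R : realType) (T : finType) (mu nu : T -> R) : R :=
  2^-1 * \sum_(x : T) `|mu x - nu x|.

(* Main.v *)
(** Write a ball configuration for the multiset of paths played. On an EP
network the arcs cut the paths into a laminar family, so the potential of a
configuration is a sum of convex functions over a laminar family. Projecting
[B_t] to [alphaB B_t] turns the base-exchange chain into the heat bath: a
uniformly chosen player forgets her path and redraws it from the conditional
Gibbs law. The heat bath is reversible, and it is compared to equilibrium in
two phases.

Burn-in. The potential is M-convex. The resulting exchange inequality shows
that resampling player [i] given all the others overestimates resampling [i]
given only the players outside a set [C] by at most a factor [#|C|.+1]. Hence
a sequence of updates that touches every player produces a law with density
at most [n!] with respect to the Gibbs law, whatever the costs are. After
[t] steps the players missed have probability at most [n (1 - 1/n)^t].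

Entropy decay. Let [D_j] be the relative entropy of the law of [j] players.
The sequence [D_j] is convex: locally this says that the pair law of the Gibbs
measure, with any players fixed, has a single positive eigenvalue. For the last
two players that follows from the laminar structure; it passes to fewer fixed
players by Oppenheim's trickle-down argument. Convexity gives
[D_(n-1) <= (1 - 1/n) D_n], so each step of the heat bath contracts the entropy
by [1 - 1/n], starting from at most [ln (2 n!)]. *)
Require Import Defs.
From HB Require Import structures.
From mathcomp Require Import all_boot all_order all_algebra.
From mathcomp Require Import fingroup perm.
From mathcomp Require Import reals.
From mathcomp Require Import sequences exp.
From mathcomp Require Import ring lra.
Import Order.TTheory GRing.Theory Num.Theory.
Local Open Scope ring_scope.
Set Implicit Arguments. Unset Strict Implicit. Unset Printing Implicit Defensive.

(** * Ball configurations *)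

Section Loads.
Variables (R : realType) (P : finType).
Implicit Types (al be ga : {ffun P -> nat}) (F G : {ffun P -> nat} -> R).

Definition incr al (a : P) : {ffun P -> nat} := [ffun p => (al p + (p == a))%N].
Definition decr al (a : P) : {ffun P -> nat} := [ffun p => (al p - (p == a))%N].
Definition total al : nat := (\sum_p al p)%N.

Lemma incrAC al a b : incr (incr al a) b = incr (incr al b) a.
Proof. by apply/ffunP => p; rewrite !ffunE addnAC. Qed.

Lemma incrK al a : decr (incr al a) a = al.
Proof. by apply/ffunP => p; rewrite !ffunE addnK. Qed.

Lemma decrK al a : (0 < al a)%N -> incr (decr al a) a = al.
Proof.
move=> h; apply/ffunP => p; rewrite !ffunE subnK //.
by case: eqP => [->|].
Qed.

Lemma decr_incr al a p : (0 < al p)%N -> decr (incr al a) p = incr (decr al p) a.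
Proof.
move=> h; apply/ffunP => q; rewrite !ffunE; case: (q =P p) => [->|_].
  by rewrite addnBAC.
by rewrite !subn0.
Qed.

Lemma total_incr al a : total (incr al a) = (total al).+1.
Proof.
rewrite /total (eq_bigr (fun p => (al p + (p == a))%N)); last by move=> p _; rewrite ffunE.
rewrite big_split /= -addn1; congr (_ + _)%N.
by rewrite (bigD1 a) //= eqxx big1 // => p /negPf ->.
Qed.

Lemma total_decr al a : (0 < al a)%N -> (total (decr al a)).+1 = total al.
Proof. by move=> h; rewrite -(total_incr _ a) decrK. Qed.

Lemma total0 : total [ffun=> 0%N] = 0%N.
Proof. by apply: big1 => p _; rewrite ffunE. Qed.

(** Sums over ordered sequences of [m] added balls, so a configuration counts with its multinomial
    multiplicity, exactly as it does among profiles. *)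
Fixpoint msum m F al : R :=
  if m is k.+1 then \sum_a msum k F (incr al a) else F al.

Lemma eq_msum m F G al :
  (forall be, total be = (total al + m)%N -> F be = G be) ->
  msum m F al = msum m G al.
Proof.
elim: m al => [|m IH] al h /=; first by apply: h; rewrite addn0.
apply: eq_bigr => a _; apply: IH => be; rewrite total_incr addSnnS; exact: h.
Qed.

Lemma msumD m F G al : msum m (fun be => F be + G be) al = msum m F al + msum m G al.
Proof.
elim: m al => [//|m IH] al /=; rewrite -big_split; apply: eq_bigr => a _; exact: IH.
Qed.

Lemma msumZ m (c : R) F al : msum m (fun be => c * F be) al = c * msum m F al.
Proof.
elim: m al => [//|m IH] al /=; rewrite mulr_sumr; apply: eq_bigr => a _; exact: IH.
Qed.

Lemma msum_sum m (I : finType) (F : I -> {ffun P -> nat} -> R) al :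
  msum m (fun be => \sum_i F i be) al = \sum_i msum m (F i) al.
Proof.
elim: m al => [//|m IH] al /=; rewrite exchange_big; apply: eq_bigr => a _; exact: IH.
Qed.

Lemma ler_msum m F G al :
  (forall be, total be = (total al + m)%N -> F be <= G be) ->
  msum m F al <= msum m G al.
Proof.
elim: m al => [|m IH] al h /=; first by apply: h; rewrite addn0.
apply: ler_sum => a _; apply: IH => be; rewrite total_incr addSnnS; exact: h.
Qed.

Lemma msum_ge0 m F al : (forall be, 0 <= F be) -> 0 <= msum m F al.
Proof. by move=> h; elim: m al => [|m IH] al //=; apply: sumr_ge0. Qed.

Lemma msum_gt0 m F al (p0 : P) : (forall be, 0 < F be) -> 0 < msum m F al.
Proof.
move=> h; elim: m al => [|m IH] al //=.
rewrite (bigD1 p0) //=; apply: ltr_wpDr => //.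
by apply: sumr_ge0 => a _; exact: ltW.
Qed.

Lemma msum_incr m F al : msum m (fun be => \sum_a F (incr be a)) al = msum m.+1 F al.
Proof.
elim: m al => [//|m IH] al /=; apply: eq_bigr => a _; exact: IH.
Qed.

(* Removing one of the [m] added balls, or one of those already in [ga]. *)
Lemma msum_decr m (K : P -> {ffun P -> nat} -> R) ga :
  msum m (fun al => \sum_p (al p)%:R * K p (decr al p)) ga =
  \sum_p (ga p)%:R * msum m (K p) (decr ga p)
  + m%:R * msum m.-1 (fun be => \sum_p K p be) ga.
Proof.
elim: m ga => [|m IH] ga; first by rewrite /= mul0r addr0.
rewrite [LHS]/= (eq_bigr _ (fun a _ => IH (incr ga a))) big_split /=.
have E1 : \sum_(i : P) m%:R * msum m.-1 (fun be => \sum_p K p be) (incr ga i)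
   = m%:R * msum m (fun be => \sum_p K p be) ga.
  by case: m {IH} => [|m]; rewrite -mulr_sumr //= !mul0r.
have E2 : \sum_(i : P) \sum_(p : P) (incr ga i p)%:R * msum m (K p) (decr (incr ga i) p)
   = \sum_p (ga p)%:R * (\sum_a msum m (K p) (incr (decr ga p) a))
     + msum m (fun be => \sum_p K p be) ga.
  rewrite msum_sum exchange_big -big_split /=; apply: eq_bigr => p _.
  rewrite (eq_bigr (fun i => (ga p)%:R * msum m (K p) (incr (decr ga p) i)
      + (p == i)%:R * msum m (K p) ga)); last first.
    move=> i _; rewrite ffunE natrD mulrDl; congr (_ + _).
      case: (posnP (ga p)) => [->|h]; first by rewrite !mul0r.
      by rewrite decr_incr.
    by case: eqP => [->|_]; rewrite ?mul0r // incrK.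
  rewrite big_split /= mulr_sumr; congr (_ + _).
  rewrite (bigD1 p) //= eqxx mul1r big1 ?addr0 // => i.
  by rewrite eq_sym => /negPf ->; rewrite mul0r.
by rewrite E1 E2 -addrA -nat1r mulrDl mul1r.
Qed.

Lemma msum_decr0 m (K : P -> {ffun P -> nat} -> R) :
  msum m (fun al => \sum_p (al p)%:R * K p (decr al p)) [ffun=> 0%N] =
  m%:R * msum m.-1 (fun be => \sum_p K p be) [ffun=> 0%N].
Proof. by rewrite msum_decr big1 ?add0r // => p _; rewrite ffunE mul0r. Qed.

End Loads.

(** * Forms with one positive eigenvalue *)

Section Lorentz.
Variables (R : realType) (P : finType).
Implicit Types (M : P -> P -> R) (f g u : P -> R).

Definition bil M f g := \sum_a \sum_b M a b * (f a * g b).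

(** Reversed Cauchy-Schwarz against the constants. For symmetric [M] of positive total mass it makes
    the form nonpositive on the functions [M]-orthogonal to the constants: one positive
    eigenvalue. *)
Definition lorentz M :=
  forall f, bil M f f * bil M (fun=> 1) (fun=> 1) <= (bil M (fun=> 1) f) ^+ 2.

Lemma bilBZ M f g (s : R) : (forall a b, M a b = M b a) ->
  bil M (fun a => f a - s * g a) (fun a => f a - s * g a)
  = bil M f f - 2 * s * bil M f g + s ^+ 2 * bil M g g.
Proof.
move=> sM; have E : bil M f g = bil M g f.
  rewrite /bil exchange_big; apply: eq_bigr => a _; apply: eq_bigr => b _.
  by rewrite sM (mulrC (f b)).
have -> : 2 * s * bil M f g = s * bil M f g + s * bil M g f by rewrite -E; ring.
rewrite /bil !mulr_sumr -big_split -sumrB -big_split; apply: eq_bigr => a _ /=.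
rewrite !mulr_sumr -big_split -sumrB -big_split; apply: eq_bigr => b _ /=.
ring.
Qed.

(* Reversed Cauchy-Schwarz for a form "square of a linear form minus a positive form". *)
Lemma lorentz_of_square M (l : P -> R) : (forall a b, M a b = M b a) ->
  0 < bil M (fun=> 1) (fun=> 1) ->
  (forall f, bil M f f <= (\sum_a l a * f a) ^+ 2) -> lorentz M.
Proof.
move=> sM; set B1 := bil M _ _ => B1gt hM f.
set L := \sum_a l a.
have L1 : \sum_a l a * 1 = L by apply: eq_bigr => a _; rewrite mulr1.
have L0 : L != 0.
  apply/eqP => L0; have := hM (fun=> 1).
  by rewrite L1 L0 expr0n /= leNgt => /negP; apply; exact: B1gt.
(* With this [s] the linear form [l] vanishes on [f - s], so the form is nonpositive there;
   expanding and completing the square gives the claim. *)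
set s := (\sum_a l a * f a) / L.
have := hM (fun a => f a - s * 1).
rewrite (_ : \sum_a _ = 0); last first.
  rewrite (eq_bigr (fun a => l a * f a - s * l a)); last by move=> a _; ring.
  by rewrite sumrB -mulr_sumr -/L /s divfK ?subrr.
rewrite bilBZ // expr0n /= -/B1.
have -> : bil M f (fun=> 1) = bil M (fun=> 1) f.
  rewrite /bil exchange_big; apply: eq_bigr => a _; apply: eq_bigr => b _.
  by rewrite sM (mulrC (f b)).
set b := bil M (fun=>1) f; set B := bil M f f => h.
have : (B - 2 * s * b + s ^+ 2 * B1) * B1 <= 0 by apply: mulr_le0_ge0 => //; exact: ltW.
have := sqr_ge0 (b - s * B1); rewrite -/B1; nra.
Qed.

(** * Trickle-down without the spectral theorem *)

Section Trickle.
Variable M : P -> P -> R.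
Hypothesis Msym : forall a b, M a b = M b a.
Hypothesis Mpos : forall a b, 0 < M a b.
(** [M] is read as a weighted graph: [d] is the degree, [A] the random-walk operator, [dd] the inner
    product for which [A] is self-adjoint and [bil M f g] pairs [f] with [A g]. *)
Let d a := \sum_b M a b.
Let Z := \sum_a d a.
Let A f a := (\sum_b M a b * f b) / d a.
Let dd f g := \sum_a d a * (f a * g a).

(** This is [A <= A^2]: an eigenvalue is nonpositive or at least [1]. Since [M] is positive the
    eigenvalue [1] is simple, so all the others are nonpositive. *)
Hypothesis hA : forall f, bil M f f <= dd (A f) (A f).

Let d_gt0 a : 0 < d a.
Proof.
rewrite /d (bigD1 a) //=; apply: ltr_wpDr => //.
by apply: sumr_ge0 => b _; exact: ltW.
Qed.

Let ddBZ f g s : dd (fun a => f a - s * g a) (fun a => f a - s * g a)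
  = dd f f - 2 * s * dd f g + s ^+ 2 * dd g g.
Proof.
rewrite /dd !mulr_sumr -sumrB -big_split; apply: eq_bigr => a _ /=; ring.
Qed.

Let bilA f g : bil M f g = dd f (A g).
Proof.
rewrite /bil /dd; apply: eq_bigr => a _.
rewrite /A mulrCA (mulrC (d a)) divfK ?gt_eqF //.
rewrite mulr_sumr; apply: eq_bigr => b _; ring.
Qed.

Let dA f : \sum_a d a * A f a = \sum_a d a * f a.
Proof.
rewrite (eq_bigr (fun a => \sum_b M a b * f b)); last first.
  by move=> a _; rewrite /A mulrC divfK ?gt_eqF.
rewrite exchange_big; apply: eq_bigr => b _; rewrite /d mulr_suml.
by apply: eq_bigr => a _; rewrite Msym.
Qed.

Let dd_ge0 f : 0 <= dd f f.
Proof.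
apply: sumr_ge0 => a _; apply: mulr_ge0; first exact: ltW.
by rewrite -expr2 sqr_ge0.
Qed.

(** Adding [dd f f] to the form gives half the weighted sum of [(f a + f b) ^+ 2]. *)
Let bil_geN f : - dd f f <= bil M f f.
Proof.
rewrite -subr_ge0 opprK.
have -> : bil M f f + dd f f = 2^-1 * \sum_a \sum_b M a b * (f a + f b) ^+ 2.
  have -> : dd f f = 2^-1 * (\sum_a \sum_b M a b * f a ^+ 2 + \sum_a \sum_b M a b * f b ^+ 2).
    have E : \sum_a \sum_b M a b * f b ^+ 2 = \sum_a \sum_b M a b * f a ^+ 2.
      rewrite exchange_big; apply: eq_bigr => a _; apply: eq_bigr => b _.
      by rewrite Msym.
    rewrite E (_ : forall x : R, 2^-1 * (x + x) = x) ?/dd; last by move=> x; field.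
    apply: eq_bigr => a _.
    by rewrite /d mulr_suml; apply: eq_bigr => b _; rewrite expr2.
  rewrite /bil mulrDr !mulr_sumr -!big_split; apply: eq_bigr => a _ /=.
  rewrite !mulr_sumr -!big_split; apply: eq_bigr => b _ /=.
  by field.
apply: mulr_ge0; first by rewrite invr_ge0.
apply: sumr_ge0 => a _; apply: sumr_ge0 => b _.
by apply: mulr_ge0; [exact: ltW | exact: sqr_ge0].
Qed.

(* On the orthogonal of the constants, [A <= k] and [- 1 <= A] give
   [(k - A)^2 <= (k + 1) (k - A)], and [A <= A^2] then improves [k]. *)
Let improve (k : R) : 0 <= k -> k < 1 ->
  (forall g, \sum_a d a * g a = 0 -> bil M g g <= k * dd g g) ->
  forall g, \sum_a d a * g a = 0 -> bil M g g <= (k / (2 - k)) * dd g g.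
Proof.
move=> k0 k1 hk g gd.
pose X a := k * g a - A g a.
have ddXX : dd X X = k ^+ 2 * dd g g - 2 * k * bil M g g + dd (A g) (A g).
  rewrite bilA /dd !mulr_sumr -sumrB -big_split; apply: eq_bigr => a _ /=; rewrite /X; ring.
have xgX : k * dd g X - bil M g X = dd X X.
  have -> : bil M g X = bil M X g.
    rewrite /bil exchange_big; apply: eq_bigr => a _; apply: eq_bigr => b _.
    by rewrite Msym (mulrC (g b)).
  rewrite bilA /dd mulr_sumr -sumrB; apply: eq_bigr => a _ /=; rewrite /X; ring.
(* Cauchy-Schwarz for the form [k - A] by hand: the hypothesis is tested on [g - s X], and this [s]
   is optimal once the form at [X] is bounded by [(k + 1) * dd X X]. *)
pose s := (k + 1)^-1.
have k1gt : 0 < k + 1 by lra.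
have sE : s * (k + 1) = 1 by rewrite mulVf ?gt_eqF.
have s0 : 0 < s by rewrite invr_gt0.
have hd : \sum_a d a * (g a - s * X a) = 0.
  rewrite (eq_bigr (fun a => (1 - s * k) * (d a * g a) + s * (d a * A g a))); last first.
    by move=> a _; rewrite /X; ring.
  by rewrite big_split /= -!mulr_sumr dA gd !mulr0 addr0.
have := hk _ hd; rewrite bilBZ // ddBZ.
have hX := bil_geN X.
have hg := hA g.
have key : dd X X <= (k + 1) * (k * dd g g - bil M g g) ->
  bil M g g <= k / (2 - k) * dd g g.
  rewrite ddXX => h.
  have k2 : 0 < 2 - k by lra.
  by rewrite mulrAC ler_pdivlMr //; lra.
move=> h; apply: key.
have : s * dd X X <= k * dd g g - bil M g g.
  have : s ^+ 2 * (k * dd X X - bil M X X) <= s * dd X X.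
    have -> : s * dd X X = s ^+ 2 * ((k + 1) * dd X X).
      by rewrite mulrA expr2 -(mulrA s s) sE mulr1.
    by apply: ler_wpM2l; [exact: sqr_ge0 | lra].
  move: h xgX; set u := dd g X; set v := bil M g X => h xgX.
  have : k * (- 2 * s * u) + 2 * s * v = - 2 * s * dd X X by rewrite -xgX; ring.
  lra.
rewrite -(ler_pM2l k1gt) mulrA (mulrC (k + 1)) sE mul1r; done.
Qed.

(** The map [k / (2 - k)] sends [(1 + y)^-1] to [(1 + 2 y)^-1]; since [y >= x], each round gains at
    least [x]. *)
Let improve_iter (x : R) : 0 < x ->
  (forall g, \sum_a d a * g a = 0 -> bil M g g <= (1 + x)^-1 * dd g g) ->
  forall j g, \sum_a d a * g a = 0 -> bil M g g <= (1 + j.+1%:R * x)^-1 * dd g g.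
Proof.
move=> x0 h; elim=> [|j IH] g gd; first by rewrite mul1r; exact: h.
have jx : 0 < j.+1%:R * x by rewrite mulr_gt0 ?ltr0n.
have kgt : 0 < 1 + j.+1%:R * x by lra.
apply: le_trans (improve _ _ IH gd) _.
- by rewrite invr_ge0 ltW.
- by rewrite invf_lt1 //; lra.
apply: ler_wpM2r; first exact: dd_ge0.
have -> : (1 + j.+1%:R * x)^-1 / (2 - (1 + j.+1%:R * x)^-1) = (1 + 2 * (j.+1%:R * x))^-1.
  by field; rewrite !gt_eqF //=; lra.
rewrite lef_pV2 ?posrE; [|lra|]; last by rewrite -[in j.+2%:R]natr1 mulrDl; lra.
rewrite -[in j.+2%:R]natr1 mulrDl mul1r lerD2l.
have : x <= j.+1%:R * x by rewrite -[leLHS]mul1r ler_pM2r // ler1n.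
lra.
Qed.

(** Doeblin minorisation: positive entries give [M a b >= th * d a * d b / Z] with [th > 0].
    Subtracting this rank-one part, invisible to mean-zero functions, leaves nonnegative weights and
    the factor [1 - th <= (1 + th)^-1]. *)
Let gap : 0 < Z -> exists2 x : R, 0 < x &
  forall g, \sum_a d a * g a = 0 -> bil M g g <= (1 + x)^-1 * dd g g.
Proof.
move=> Z0.
have q0 a b : 0 <= d a * d b / (M a b * Z).
  by apply: divr_ge0; apply: ltW; apply: mulr_gt0.
pose S := \sum_a \sum_b d a * d b / (M a b * Z).
have S0 : 0 <= S by apply: sumr_ge0 => a _; apply: sumr_ge0.
pose th := (1 + S)^-1.
have th0 : 0 < th by rewrite invr_gt0; lra.
have thM a b : th * (d a * d b) / Z <= M a b.
  have : d a * d b / (M a b * Z) <= 1 + S.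
    have : d a * d b / (M a b * Z) <= S.
      rewrite /S (bigD1 a) //= (bigD1 b) //= -addrA lerDl.
      by apply: addr_ge0; apply: sumr_ge0 => // i _; apply: sumr_ge0.
    lra.
  rewrite ler_pdivrMr ?mulr_gt0 // => h.
  rewrite ler_pdivrMr // -(ler_pM2l (_ : 0 < 1 + S)); last lra.
  by rewrite mulrA mulfV ?mul1r // lt0r_neq0 //; lra.
exists th => // g gd.
have h1 : bil M g g <= (1 - th) * dd g g.
  rewrite -subr_ge0.
  have -> : (1 - th) * dd g g - bil M g g =
      2^-1 * \sum_a \sum_b (M a b - th * (d a * d b) / Z) * (g a - g b) ^+ 2.
    have E1 : \sum_a \sum_b (M a b - th * (d a * d b) / Z) * (g a) ^+ 2 = (1 - th) * dd g g.
      rewrite /dd mulr_sumr; apply: eq_bigr => a _.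
      rewrite -mulr_suml sumrB.
      have -> : \sum_b th * (d a * d b) / Z = th * d a.
        rewrite (eq_bigr (fun b => th * d a / Z * d b)); last by move=> b _; ring.
        by rewrite -mulr_sumr -/Z divfK ?gt_eqF.
      by rewrite -/(d a) expr2; ring.
    have E2 : \sum_a \sum_b (M a b - th * (d a * d b) / Z) * (g b) ^+ 2 = (1 - th) * dd g g.
      rewrite -E1 exchange_big; apply: eq_bigr => a _; apply: eq_bigr => b _.
      by rewrite Msym (mulrC (d b)).
    have E3 : \sum_a \sum_b (M a b - th * (d a * d b) / Z) * (g a * g b) = bil M g g.
      transitivity (bil M g g - th / Z * ((\sum_a d a * g a) * (\sum_a d a * g a))).
        rewrite /bil mulr_suml [th / Z * _]mulr_sumr -sumrB; apply: eq_bigr => a _.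
        rewrite !mulr_sumr -sumrB; apply: eq_bigr => b _; ring.
      by rewrite gd !mulr0 subr0.
    have -> : (1 - th) * dd g g - bil M g g =
      2^-1 * ((1 - th) * dd g g + (1 - th) * dd g g - 2 * bil M g g) by field.
    congr (_ * _); rewrite -{1}E1 -E2 -E3 mulr_sumr -big_split -sumrB.
    apply: eq_bigr => a _ /=; rewrite mulr_sumr -big_split -sumrB.
    by apply: eq_bigr => b _ /=; ring.
  apply: mulr_ge0; first by rewrite invr_ge0.
  apply: sumr_ge0 => a _; apply: sumr_ge0 => b _.
  by apply: mulr_ge0; [rewrite subr_ge0 | exact: sqr_ge0].
apply: le_trans h1 _; apply: ler_wpM2r; first exact: dd_ge0.
rewrite -[leRHS]mul1r ler_pdivlMr; last lra.
have := sqr_ge0 th; rewrite expr2; lra.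
Qed.

(** Iterating the improvement drives the bound on mean-zero functions to [0]; subtracting from [f]
    its mean then yields the inequality. *)
Lemma lorentz_of_le_square : lorentz M.
Proof.
move=> f.
have BZ : bil M (fun=> 1) (fun=> 1) = Z.
  rewrite /bil /Z; apply: eq_bigr => a _; apply: eq_bigr => b _; ring.
rewrite BZ.
have [Z0|Z0] := lerP Z 0.
  have -> : Z = 0 by apply/le_anti; rewrite Z0 /=; apply: sumr_ge0 => a _; exact: ltW.
  by rewrite mulr0 sqr_ge0.
have [x x0 hx] := gap Z0.
have neg g : \sum_a d a * g a = 0 -> bil M g g <= 0.
  move=> gd; rewrite leNgt; apply/negP => Bg.
  have Bx : 0 < bil M g g * x by rewrite mulr_gt0.
  (* For [j] this large a positive value of the form would exceed the bound of round [j]. *)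
  have := truncnS_gt (dd g g / (bil M g g * x)).
  set j := Num.truncn _; rewrite ltr_pdivrMr // => hj.
  have := improve_iter x0 hx j gd.
  have jx : 0 < j.+1%:R * x by rewrite mulr_gt0 ?ltr0n.
  by rewrite mulrC ler_pdivlMr; lra.
have bs : bil M f (fun=> 1) = bil M (fun=> 1) f.
  rewrite /bil exchange_big; apply: eq_bigr => a _; apply: eq_bigr => b _.
  by rewrite Msym (mulrC (f b)).
have bf : bil M (fun=> 1) f = \sum_a d a * f a.
  rewrite -bs /bil; apply: eq_bigr => a _; rewrite mulr_suml; apply: eq_bigr => b _; ring.
pose c := (\sum_a d a * f a) / Z.
have cZ : c * Z = bil M (fun=> 1) f by rewrite bf divfK ?gt_eqF.
have gd : \sum_a d a * (f a - c * 1) = 0.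
  rewrite (eq_bigr (fun a => d a * f a - c * d a)); last by move=> a _; ring.
  by rewrite sumrB -mulr_sumr -/Z cZ bf subrr.
have := neg _ gd; rewrite bilBZ // bs BZ => h.
have : (bil M f f - 2 * c * bil M (fun=> 1) f + c ^+ 2 * Z) * Z <= 0.
  by apply: mulr_le0_ge0 => //; exact: ltW.
by rewrite -cZ; nra.
Qed.
End Trickle.

(** Full symmetry of [T] identifies the row sums of [T c] with row [c] of the summed matrix. The
    inequality for [T c] then bounds its form by [d c * (A f c) ^+ 2], and summing over [c] gives
    [A <= A^2]. *)
Lemma lorentz_sum (T : P -> P -> P -> R) :
  (forall a b c, T a b c = T b a c) -> (forall a b c, T a b c = T a c b) ->
  (forall a b c, 0 < T a b c) -> (forall c, lorentz (T c)) ->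
  lorentz (fun a b => \sum_c T c a b).
Proof.
move=> T12 T23 Tp hT.
apply: lorentz_of_le_square.
- by move=> a b; apply: eq_bigr => c _.
- move=> a b; rewrite (bigD1 a) //=; apply: ltr_wpDr => //.
  by apply: sumr_ge0 => c _; exact: ltW.
move=> f.
have -> : bil (fun a b => \sum_c T c a b) f f = \sum_c bil (T c) f f.
  rewrite /bil [RHS]exchange_big; apply: eq_bigr => a _ /=.
  rewrite [RHS]exchange_big; apply: eq_bigr => b _ /=.
  by rewrite mulr_suml.
apply: ler_sum => c _.
have d0 : 0 < \sum_b \sum_c0 T c0 c b.
  rewrite (bigD1 c) //= (bigD1 c) //= -addrA; apply: ltr_wpDr => //.
  apply: addr_ge0; apply: sumr_ge0 => i _; first exact: ltW.
  by apply: sumr_ge0 => j _; exact: ltW.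
have := hT c f.
have -> : bil (T c) (fun=> 1) (fun=> 1) = \sum_b \sum_c0 T c0 c b.
  rewrite /bil exchange_big; apply: eq_bigr => a _; apply: eq_bigr => b _.
  by rewrite !mulr1 T12.
have -> : bil (T c) (fun=> 1) f = \sum_b (\sum_c0 T c0 c b) * f b.
  rewrite /bil exchange_big; apply: eq_bigr => a _; rewrite mulr_suml; apply: eq_bigr => b _.
  by rewrite mul1r T12.
rewrite -ler_pdivlMr // => h; apply: le_trans h _.
by rewrite expr2 le_eqVlt; apply/orP; left; apply/eqP; field; rewrite gt_eqF.
Qed.
End Lorentz.

(** * Entropy contraction of the heat bath *)

Section RelativeEntropy.
Variables (R : realType) (P : finType).

Lemma ln_le_subr1 (u : R) : 0 < u -> ln u <= u - 1.
Proof. by move=> u0; rewrite -{1}(subrKC 1 u); apply: le_ln1Dx; lra. Qed.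

Lemma xlnx_tangent (x y : R) : 0 <= x -> 0 < y ->
  y * ln y + (ln y + 1) * (x - y) <= x * ln x.
Proof.
move=> x0 y0; case: (ltrgt0P x) x0 => // [x0|->] _; last by rewrite mul0r; lra.
have := ln_le_subr1 (divr_gt0 y0 x0); rewrite ln_div ?posrE // => h.
have : x * (ln y - ln x) <= x * (y / x - 1) by rewrite ler_pM2l.
by rewrite mulrBr (mulrBr x (y / x)) mulr1 mulrCA divff ?gt_eqF //; lra.
Qed.

Lemma xlnx_jensen (I : finType) (w g : I -> R) :
  (forall i, 0 <= w i) -> \sum_i w i = 1 -> (forall i, 0 <= g i) ->
  (\sum_i w i * g i) * ln (\sum_i w i * g i) <= \sum_i w i * (g i * ln (g i)).
Proof.
move=> w0 w1 g0; set y := \sum_i _.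
have wg0 i : 0 <= w i * g i by apply: mulr_ge0.
have [y0|y0|y0] := ltrgt0P y.
- have -> : y * ln y = \sum_i w i * (y * ln y + (ln y + 1) * (g i - y)).
    rewrite (eq_bigr (fun i => w i * (y * ln y - (ln y + 1) * y) + (ln y + 1) * (w i * g i))).
      by rewrite big_split /= -mulr_suml -mulr_sumr w1 -/y; ring.
    by move=> i _; ring.
  by apply: ler_sum => i _; apply: ler_wpM2l => //; exact: xlnx_tangent.
- by suff: 0 <= y by [rewrite leNgt y0]; apply: sumr_ge0.
rewrite y0 mul0r; apply: sumr_ge0 => i _.
have /eqP : w i * g i = 0.
  apply/eqP; rewrite eq_le wg0 andbT -y0 /y (bigD1 i) //= lerDl.
  by apply: sumr_ge0 => j _.
by rewrite mulrA => /eqP ->; rewrite mul0r.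
Qed.

Definition relent (N M : R) := N * ln (N / M).

(** With [f] the density of the marginal and [F] that of the total, the difference of the sides is
    the sum of [N a b * ln (N a b * F / (M a b * f a * f b))]. By [ln u <= u - 1] it is at least
    [Nt - bil M f f / F], which is nonnegative by [lorentz M] at [f]. *)
Lemma relent_lorentz (M N : P -> P -> R) :
  (forall a b, M a b = M b a) -> (forall a b, 0 < M a b) -> lorentz M ->
  (forall a b, N a b = N b a) -> (forall a b, 0 <= N a b) ->
  2 * (\sum_a relent (\sum_b N a b) (\sum_b M a b)) <=
  relent (\sum_a \sum_b N a b) (\sum_a \sum_b M a b) +
  \sum_a \sum_b relent (N a b) (M a b).
Proof.
move=> Ms M0 ML Ns N0.
pose n a := \sum_b N a b; pose m a := \sum_b M a b.
set Nt := \sum_a \sum_b N a b; set Mt := \sum_a \sum_b M a b.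
have n0 a : 0 <= n a by apply: sumr_ge0.
have Nn a b : N a b <= n a.
  by rewrite /n (bigD1 b) //= lerDl; apply: sumr_ge0.
have m0 (a : P) : 0 < m a.
  by rewrite /m (bigD1 a) //=; apply: ltr_wpDr => //; apply: sumr_ge0 => b _; exact: ltW.
have [Nt0|Nt0|Nt0] := ltrgt0P Nt; last first.
- have nz a : n a = 0.
    apply/eqP; rewrite eq_le n0 andbT -Nt0 /Nt (bigD1 a) //= lerDl.
    by apply: sumr_ge0 => j _; exact: n0.
  have Nz a b : N a b = 0 by apply/eqP; rewrite eq_le N0 andbT -(nz a) Nn.
  rewrite big1 => [|a _]; last by rewrite -/(n a) nz /relent mul0r.
  rewrite /relent Nt0 mul0r add0r mulr0 big1 // => a _.
  by rewrite big1 // => b _; rewrite Nz mul0r.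
- by suff: 0 <= Nt by [rewrite leNgt Nt0]; apply: sumr_ge0 => a _; exact: n0.
have Mt0 : 0 < Mt.
  rewrite lt0r; apply/andP; split; last by apply: sumr_ge0 => a _; exact: ltW (m0 a).
  apply/eqP => Mt0.
  have : Nt = 0.
    apply: big1 => a _; have := m0 a; suff -> : m a = 0 by rewrite ltxx.
    apply/eqP; rewrite eq_le (ltW (m0 a)) andbT -Mt0 /Mt (bigD1 a) //= lerDl.
    by apply: sumr_ge0 => j _; exact/ltW/m0.
  by move=> h; move: Nt0; rewrite h ltxx.
pose f a := n a / m a.
have f0 a : 0 <= f a by apply: divr_ge0 => //; exact: ltW.
pose F := Nt / Mt.
have F0 : 0 < F by apply: divr_gt0.
have E1 : \sum_a relent (n a) (m a) = \sum_a \sum_b N a b * ln (f a).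
  by apply: eq_bigr => a _; rewrite -mulr_suml.
(* Symmetry of [N] lets the two copies of the marginal term carry [ln (f a)] and [ln (f b)]. *)
have E2 : \sum_a relent (n a) (m a) = \sum_a \sum_b N a b * ln (f b).
  by rewrite E1 exchange_big; apply: eq_bigr => a _; apply: eq_bigr => b _; rewrite Ns.
have E3 : relent Nt Mt = \sum_a \sum_b N a b * ln F.
  by rewrite /relent /Nt mulr_suml; apply: eq_bigr => a _; rewrite mulr_suml.
rewrite -subr_ge0 mulr2n mulrDl !mul1r {1}E1 E2 E3 opprD addrA.
rewrite addrC !addrA -!sumrN -!big_split /=.
rewrite (eq_bigr (fun a => \sum_b N a b * (ln (N a b / M a b) - ln (f a) - ln (f b) + ln F))); last first.
  move=> a _; rewrite -!sumrN -!big_split /=; apply: eq_bigr => b _; rewrite /relent; ring.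
have key a b : N a b - M a b * (f a * f b) / F <=
   N a b * (ln (N a b / M a b) - ln (f a) - ln (f b) + ln F).
  have [Nab|Nab|Nab] := ltrgt0P (N a b).
  - have na0 : 0 < n a by apply: lt_le_trans (Nn a b).
    have nb0 : 0 < n b by apply: lt_le_trans (Nn b a); rewrite Ns.
    have fa : 0 < f a by apply: divr_gt0.
    have fb : 0 < f b by apply: divr_gt0.
    pose u := (M a b * (f a * f b)) / (N a b * F).
    have ff : 0 < f a * f b by apply: mulr_gt0.
    have u1 : 0 < M a b * (f a * f b) by apply: mulr_gt0.
    have u2 : 0 < N a b * F by apply: mulr_gt0.
    have u0 : 0 < u by apply: divr_gt0.
    have h : ln u = ln (M a b) + (ln (f a) + ln (f b)) - (ln (N a b) + ln F).
      by rewrite /u ln_div ?posrE // [ln (M a b * _)]lnM ?posrE // [ln (f a * _)]lnM ?posrE // [ln (N a b * _)]lnM ?posrE.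
    have {}h : 1 - u <= ln (N a b) - ln (M a b) - ln (f a) - ln (f b) + ln F.
      by have := ln_le_subr1 u0; rewrite h; lra.
    rewrite ln_div ?posrE //; move: h; rewrite -(ler_pM2l Nab); apply: le_trans.
    rewrite mulrBr mulr1 lerD2l lerN2 /u le_eqVlt; apply/orP; left; apply/eqP.
    by field; rewrite !gt_eqF.
  - by move: (N0 a b); rewrite leNgt Nab.
  rewrite Nab mul0r sub0r oppr_le0 divr_ge0 ?(ltW F0) // mulr_ge0 ?(ltW (M0 _ _)) //.
  by rewrite mulr_ge0.
apply: (@le_trans _ _ (\sum_a \sum_b (N a b - M a b * (f a * f b) / F))); last first.
  by apply: ler_sum => a _; apply: ler_sum.
rewrite (eq_bigr (fun a => \sum_b N a b - (\sum_b M a b * (f a * f b)) / F)); last first.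
  by move=> a _; rewrite sumrB mulr_suml.
rewrite sumrB -mulr_suml -/Nt -/(bil M f f) subr_ge0 ler_pdivrMr //.
have := ML f.
have -> : bil M (fun=> 1) (fun=> 1) = Mt.
  by apply: eq_bigr => a _; apply: eq_bigr => b _; rewrite !mulr1.
have -> : bil M (fun=> 1) f = Nt.
  rewrite /bil exchange_big; apply: eq_bigr => b _ /=.
  rewrite (eq_bigr (fun a => M b a * f b)); last by move=> a _; rewrite mul1r Ms.
  by rewrite -mulr_suml -/(m b) /f mulrC divfK ?gt_eqF.
by rewrite -ler_pdivlMr // expr2 mulrA.
Qed.
End RelativeEntropy.

(** * Heat bath on configurations: reversibility and entropy contraction *)

Section HeatBath.
Variables (R : realType) (P : finType) (p0 : P).
Variable phi : {ffun P -> nat} -> R.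
Hypothesis phi_gt0 : forall al, 0 < phi al.
Hypothesis phi_lorentz : forall m al,
  lorentz (fun a b => msum m phi (incr (incr al a) b)).
Implicit Types (al be : {ffun P -> nat}) (f h : {ffun P -> nat} -> R).
Notation zero := [ffun=> 0%N].

Definition cond h be : R :=
  (\sum_a phi (incr be a) * h (incr be a)) / \sum_a phi (incr be a).

(** A uniform ball is removed and redrawn. For [al p = 0] the truncated [decr] returns [al], but the
    coefficient is then zero. *)
Definition heat_bath n h al : R := \sum_p (al p)%:R / n%:R * cond h (decr al p).

Definition expect n h : R := msum n (fun al => phi al * h al) zero.

Definition entropy n h : R := msum n (fun al => phi al * (h al * ln (h al))) zero.

Lemma phi1_gt0 be : 0 < \sum_a phi (incr be a).
Proof. exact: (@msum_gt0 _ _ 1 phi be p0). Qed.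

Lemma cond_ge0 h be : (forall al, 0 <= h al) -> 0 <= cond h be.
Proof.
move=> h0; apply: divr_ge0; last exact/ltW/phi1_gt0.
by apply: sumr_ge0 => a _; rewrite mulr_ge0 // ltW.
Qed.

Lemma heat_bath_ge0 n h al : (forall be, 0 <= h be) -> 0 <= heat_bath n h al.
Proof.
move=> h0; apply: sumr_ge0 => p _; apply: mulr_ge0; first exact: divr_ge0.
exact: cond_ge0.
Qed.

(** Among ordered sequences, removing a uniform ball from [n.+1] balls is the same as adding one to
    [n] balls. *)
Lemma msum_heat_bath n (f : {ffun P -> nat} -> R) (c : {ffun P -> nat} -> R) :
  msum n.+1 (fun al => f al * \sum_p (al p)%:R / n.+1%:R * c (decr al p)) zero
  = msum n (fun be => (\sum_a f (incr be a)) * c be) zero.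
Proof.
transitivity (n.+1%:R^-1 * msum n.+1 (fun al => \sum_p (al p)%:R *
   (f (incr (decr al p) p) * c (decr al p))) zero).
  rewrite -msumZ; apply: eq_msum => al _; rewrite !mulr_sumr; apply: eq_bigr => p _.
  case: (posnP (al p)) => [->|h]; first by rewrite !(mul0r, mulr0).
  by rewrite decrK //; ring.
rewrite (msum_decr0 n.+1 (fun p be => f (incr be p) * c be)) /= mulKf ?pnatr_eq0 //.
by apply: eq_msum => be _; rewrite mulr_suml.
Qed.

(** Reversibility: both sides equal the symmetric pairing of [cond f] with [cond h] over
    configurations of [n] balls. *)
Lemma expect_heat_bath_adj n f h :
  expect n.+1 (fun al => f al * heat_bath n.+1 h al) =
  expect n.+1 (fun al => heat_bath n.+1 f al * h al).
Proof.
have E f' h' : expect n.+1 (fun al => f' al * heat_bath n.+1 h' al) =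
   msum n (fun be => (\sum_a phi (incr be a)) * (cond f' be * cond h' be)) zero.
  rewrite /expect; under eq_msum do rewrite mulrA.
  rewrite msum_heat_bath; apply: eq_msum => be _.
  by rewrite mulrA; congr (_ * _); rewrite mulrC divfK // gt_eqF ?phi1_gt0.
rewrite E; transitivity (expect n.+1 (fun al => h al * heat_bath n.+1 f al)).
  by rewrite E; apply: eq_msum => be _; rewrite (mulrC (cond f be)).
by apply: eq_msum => al _; rewrite (mulrC (h al)).
Qed.

Lemma heat_bath1 n al : total al = n.+1 -> heat_bath n.+1 (fun=> 1) al = 1.
Proof.
move=> tal; rewrite /heat_bath.
rewrite (eq_bigr (fun p => (al p)%:R / n.+1%:R)); last first.
  move=> p _; rewrite /cond (eq_bigr (fun a => phi (incr (decr al p) a))) ?divff ?mulr1 //.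
    by rewrite gt_eqF ?phi1_gt0.
  by move=> a _; rewrite mulr1.
by rewrite -mulr_suml -natr_sum -/(total al) tal divff ?pnatr_eq0.
Qed.

Lemma expect_heat_bath n h : expect n.+1 (heat_bath n.+1 h) = expect n.+1 h.
Proof.
transitivity (expect n.+1 (fun al => (fun=> 1) al * heat_bath n.+1 h al)).
  by apply: eq_msum => al _; rewrite mul1r.
rewrite expect_heat_bath_adj; apply: eq_msum => al tal.
by rewrite heat_bath1 ?mul1r // tal total0.
Qed.

(** [ent h k m] below is the unnormalised relative entropy [D_k] of the law of [k] balls out of
    [k + m], the other [m] being summed out. *)
Let Nm h m al := msum m (fun be => phi be * h be) al.
Let ent h k m := msum k (fun al => relent (Nm h m al) (msum m phi al)) zero.

(** With [k] balls fixed, [relent_lorentz] is applied to the joint weights of two further balls, the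
    last [m] being summed out. *)
Let ent_convex h k m : (forall al, 0 <= h al) ->
  2 * ent h k.+1 m.+1 <= ent h k m.+2 + ent h k.+2 m.
Proof.
move=> h0.
rewrite /ent -(msum_incr k.+1) -(msum_incr k) -msumZ -msum_incr -msumD.
apply: ler_msum => al _ /=.
apply: relent_lorentz.
- by move=> a b; rewrite incrAC.
- by move=> a b; apply: msum_gt0.
- exact: phi_lorentz.
- by move=> a b; rewrite /Nm incrAC.
- by move=> a b; apply: msum_ge0 => be; rewrite mulr_ge0 // ltW.
Qed.

(** Convexity together with [D_0 = 0], which is the equality of masses, makes [D_j / j]
    nondecreasing. *)
Let ent_contract h n : (forall al, 0 <= h al) -> expect n.+1 h = expect n.+1 (fun=> 1) ->
  n.+1%:R * ent h n 1 <= n%:R * ent h n.+1 0.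
Proof.
move=> h0 Eh.
have X0 : ent h 0 n.+1 = 0.
  rewrite /ent /= /relent /Nm -/(expect n.+1 h) Eh.
  suff -> : expect n.+1 (fun=> 1) = msum n.+1 phi zero by rewrite divff ?ln1 ?mulr0 // gt_eqF ?(msum_gt0 _ _ p0).
  by apply: eq_msum => al _; rewrite mulr1.
suff H j : (j <= n)%N -> j.+1%:R * ent h j (n.+1 - j) <= j%:R * ent h j.+1 (n - j).
  by have := H n (leqnn n); rewrite subnn subSnn.
elim: j => [|j IH] jn; first by rewrite subn0 X0 mulr0 mul0r.
have := IH (ltnW jn); have := @ent_convex h j (n - j.+1) h0.
have e1 : (n - j)%N = (n - j.+1).+1 by rewrite subnSK.
have e2 : (n.+1 - j)%N = (n - j.+1).+2 by rewrite subSn ?e1 // ltnW.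
rewrite subSS e1 e2 -[j.+2%:R]natr1 -[j.+1%:R]natr1.
set x := ent h j _; set y := ent h j.+1 _; set z := ent h j.+2 _.
have : 0 <= j%:R :> R by [].
set t := j%:R => t0 hc hi.
have : (t + 1) * (2 * y) <= (t + 1) * (x + z) by apply: ler_wpM2l => //; lra.
lra.
Qed.

(** Forgetting a ball brings the entropy down to that of [n] balls, hence the factor; by Jensen,
    redrawing it cannot increase the entropy. *)
Theorem entropy_heat_bath n h : (forall al, 0 <= h al) ->
  expect n.+1 h = expect n.+1 (fun=> 1) ->
  entropy n.+1 (heat_bath n.+1 h) <= (1 - n.+1%:R^-1) * entropy n.+1 h.
Proof.
move=> h0 Eh.
have c0 be : 0 <= cond h be by exact: cond_ge0.
have := ent_contract h0 Eh.
have -> : ent h n.+1 0 = entropy n.+1 h.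
  apply: eq_msum => al _; rewrite /relent /Nm /= [phi al * h al / _]mulrAC mulfV ?gt_eqF //.
  by rewrite mul1r mulrA.
have -> : ent h n 1 = msum n (fun be => (\sum_a phi (incr be a)) * (cond h be * ln (cond h be))) zero.
  apply: eq_msum => be _; rewrite /relent /Nm /= mulrA; congr (_ * _).
  by rewrite mulrC divfK // gt_eqF ?phi1_gt0.
rewrite -msum_heat_bath => h1.
apply: (@le_trans _ _ (n.+1%:R^-1 * (n%:R * entropy n.+1 h))); last first.
  rewrite le_eqVlt; apply/orP; left; apply/eqP; rewrite -natr1; field.
  by rewrite natr1 pnatr_eq0.
rewrite -(ler_pM2l (_ : 0 < n.+1%:R :> R)) ?ltr0n // mulVKf ?pnatr_eq0 //.
apply: le_trans h1; rewrite ler_pM2l ?ltr0n //.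
apply: ler_msum => al; rewrite total0 add0n => tal; rewrite ler_pM2l //.
apply: xlnx_jensen => // [p|]; first exact: divr_ge0.
by rewrite -mulr_suml -natr_sum -/(total al) tal divff ?pnatr_eq0.
Qed.
End HeatBath.

(** * Extension parallel networks *)

Fixpoint some_path (g : ep) : ep_path g :=
  match g return ep_path g with
  | EArc => tt
  | EPar a b => inl (some_path a)
  | ESer a => some_path a
  end.

Section PathArcs.
Variables a b : ep.

Lemma mem_path_arcs_ll (e : ep_arc a) (q : ep_path a) :
  ((inl e : ep_arc (EPar a b)) \in path_arcs (inl q : ep_path (EPar a b))) = (e \in path_arcs q).
Proof. by rewrite /= mem_imset //; exact: inl_inj. Qed.

Lemma mem_path_arcs_rr (e : ep_arc b) (q : ep_path b) :
  ((inr e : ep_arc (EPar a b)) \in path_arcs (inr q : ep_path (EPar a b))) = (e \in path_arcs q).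
Proof. by rewrite /= mem_imset //; exact: inr_inj. Qed.

Lemma mem_path_arcs_lr (e : ep_arc a) (q : ep_path b) :
  ((inl e : ep_arc (EPar a b)) \in path_arcs (inr q : ep_path (EPar a b))) = false.
Proof. by apply/negbTE/imsetP => -[x _]. Qed.

Lemma mem_path_arcs_rl (e : ep_arc b) (q : ep_path a) :
  ((inr e : ep_arc (EPar a b)) \in path_arcs (inl q : ep_path (EPar a b))) = false.
Proof. by apply/negbTE/imsetP => -[x _]. Qed.

Lemma mem_path_arcs_None (q : ep_path a) :
  (None \in path_arcs (q : ep_path (ESer a))) = true.
Proof. by rewrite /= !inE eqxx. Qed.

Lemma mem_path_arcs_Some (e : ep_arc a) (q : ep_path a) :
  (Some e \in path_arcs (q : ep_path (ESer a))) = (e \in path_arcs q).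
Proof. by rewrite /= !inE /= mem_imset //; exact: Some_inj. Qed.
End PathArcs.

(** * Arc loads and exchange of paths *)

Definition arc_load (g : ep) (u : ep_path g -> nat) (e : ep_arc g) : nat :=
  (\sum_(p | e \in path_arcs p) u p)%N.

Section ArcLoad.
Variables a b : ep.

Lemma arc_load_inl (u : ep_path (EPar a b) -> nat) (e : ep_arc a) :
  arc_load u (inl e : ep_arc (EPar a b)) = arc_load (fun q => u (inl q)) e.
Proof.
rewrite /arc_load big_mkcond big_sumType /= [X in (_ + X)%N]big1 ?addn0.
  by rewrite [RHS]big_mkcond; apply: eq_bigr => q _; rewrite mem_path_arcs_ll.
by move=> q _; rewrite mem_path_arcs_lr.
Qed.

Lemma arc_load_inr (u : ep_path (EPar a b) -> nat) (e : ep_arc b) :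
  arc_load u (inr e : ep_arc (EPar a b)) = arc_load (fun q => u (inr q)) e.
Proof.
rewrite /arc_load big_mkcond big_sumType /= [X in (X + _)%N]big1 ?add0n.
  by rewrite [RHS]big_mkcond; apply: eq_bigr => q _; rewrite mem_path_arcs_rr.
by move=> q _; rewrite mem_path_arcs_rl.
Qed.

Lemma arc_load_None (u : ep_path (ESer a) -> nat) :
  arc_load u (None : ep_arc (ESer a)) = (\sum_q u q)%N.
Proof. by apply: eq_bigl => q; rewrite mem_path_arcs_None. Qed.

Lemma arc_load_Some (u : ep_path (ESer a) -> nat) (e : ep_arc a) :
  arc_load u (Some e : ep_arc (ESer a)) = @arc_load a u e.
Proof. by apply: eq_bigl => q; rewrite mem_path_arcs_Some. Qed.
End ArcLoad.

Lemma big_ep_path_arc (u : ep_path EArc -> nat) : (\sum_q u q)%N = u tt.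
Proof. by rewrite (big_pred1 tt) //; case. Qed.

Lemma arc_load_arc (u : ep_path EArc -> nat) (e : ep_arc EArc) : arc_load u e = u tt.
Proof. by rewrite -big_ep_path_arc; apply: eq_bigl => q; rewrite /= inE. Qed.

(** Descent through the network: at a parallel composition some branch keeps a surplus of [u], and
    the new arc of a series composition carries the whole surplus. *)
Lemma exists_overloaded_path (g : ep) (u v : ep_path g -> nat) :
  (\sum_q v q < \sum_q u q)%N ->
  exists2 b, (v b < u b)%N & forall e, e \in path_arcs b -> (arc_load v e < arc_load u e)%N.
Proof.
elim: g u v => [|a IHa b IHb|a IHa] u v h.
- move: h; rewrite !big_ep_path_arc => h.
  by exists tt => // e _; rewrite !arc_load_arc.
- move: h; rewrite !big_sumType /= => h.
  case: (ltnP (\sum_q v (inl q)) (\sum_q u (inl q))) => ha.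
    have [q hq He] := IHa (fun q => u (inl q)) (fun q => v (inl q)) ha.
    exists (inl q) => // -[e|e]; last by rewrite mem_path_arcs_rl.
    by rewrite mem_path_arcs_ll !arc_load_inl; exact: He.
  have hb : (\sum_q v (inr q) < \sum_q u (inr q))%N.
    by rewrite ltnNge; apply: contraL h => hb; rewrite -leqNgt leq_add.
  have [q hq He] := IHb (fun q => u (inr q)) (fun q => v (inr q)) hb.
  exists (inr q) => // -[e|e]; first by rewrite mem_path_arcs_lr.
  by rewrite mem_path_arcs_rr !arc_load_inr; exact: He.
have [q hq He] := IHa u v h.
exists q => // -[e|]; last by rewrite !arc_load_None.
by rewrite mem_path_arcs_Some !arc_load_Some; exact: He.
Qed.

(** The deficit of [u] along [p] travels up the recursion until a sibling branch has a surplus of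
    [u], where [exists_overloaded_path] supplies [b]; if none does, the deficit reaches the total.
    Series arcs met after that are shared by [p] and [b] and impose nothing. *)
Lemma exchange_path (g : ep) (u v : ep_path g -> nat) (p : ep_path g) :
  (u p < v p)%N ->
  ((\sum_q u q < \sum_q v q)%N /\
     (forall e, e \in path_arcs p -> (arc_load u e < arc_load v e)%N)) \/
  exists b, [/\ (v b < u b)%N,
     forall e, e \in path_arcs p -> e \notin path_arcs b -> (arc_load u e < arc_load v e)%N &
     forall e, e \in path_arcs b -> e \notin path_arcs p -> (arc_load v e < arc_load u e)%N].
Proof.
elim: g u v p => [|a IHa b IHb|a IHa] u v p h.
- case: p h => h; left; rewrite !big_ep_path_arc; split=> // e _.
  by rewrite !arc_load_arc.
- rewrite !big_sumType /=; case: p h => p h.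
    have [[hs He]|[q [hq H1 H2]]] := IHa (fun q => u (inl q)) (fun q => v (inl q)) p h.
      case: (ltnP (\sum_q v (inr q)) (\sum_q u (inr q))) => hb.
        have [q hq Hq] := exists_overloaded_path hb.
        right; exists (inr q); split=> // -[e|e].
        + by rewrite mem_path_arcs_ll !arc_load_inl => /He.
        + by rewrite mem_path_arcs_rl.
        + by rewrite mem_path_arcs_lr.
        + by rewrite mem_path_arcs_rr !arc_load_inr => /Hq.
      left; split; first by rewrite -addSn leq_add.
      move=> [e|e]; last by rewrite mem_path_arcs_rl.
      by rewrite mem_path_arcs_ll !arc_load_inl => /He.
    right; exists (inl q); split=> // -[e|e]; rewrite ?mem_path_arcs_rl //.
      by rewrite !mem_path_arcs_ll !arc_load_inl => /H1 {}H1 /H1.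
    by rewrite !mem_path_arcs_ll !arc_load_inl => /H2 {}H2 /H2.
  have [[hs He]|[q [hq H1 H2]]] := IHb (fun q => u (inr q)) (fun q => v (inr q)) p h.
    case: (ltnP (\sum_q v (inl q)) (\sum_q u (inl q))) => hb.
      have [q hq Hq] := exists_overloaded_path hb.
      right; exists (inl q); split=> // -[e|e].
      + by rewrite mem_path_arcs_lr.
      + by rewrite mem_path_arcs_rr !arc_load_inr => /He.
      + by rewrite mem_path_arcs_ll !arc_load_inl => /Hq.
      + by rewrite mem_path_arcs_rl.
    left; split; first by rewrite -addnS leq_add.
    move=> [e|e]; first by rewrite mem_path_arcs_lr.
    by rewrite mem_path_arcs_rr !arc_load_inr => /He.
  right; exists (inr q); split=> // -[e|e]; rewrite ?mem_path_arcs_lr //.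
    by rewrite !mem_path_arcs_rr !arc_load_inr => /H1 {}H1 /H1.
  by rewrite !mem_path_arcs_rr !arc_load_inr => /H2 {}H2 /H2.
have [[hs He]|[q [hq H1 H2]]] := IHa u v p h.
  left; split=> // -[e|]; last by rewrite !arc_load_None.
  by rewrite mem_path_arcs_Some !arc_load_Some => /He.
right; exists q; split=> // -[e|]; rewrite ?mem_path_arcs_None //.
  by rewrite !mem_path_arcs_Some !arc_load_Some => /H1 {}H1 /H1.
by rewrite !mem_path_arcs_Some !arc_load_Some => /H2 {}H2 /H2.
Qed.

(** * The overlap kernel of the laminar family of arcs *)

Section OverlapKernel.
Variable R : realType.

Definition overlap (g : ep) (dlt : ep_arc g -> R) (p q : ep_path g) : R :=
  \prod_(e in path_arcs p :&: path_arcs q) dlt e.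

Lemma overlapE (g : ep) (dlt : ep_arc g -> R) p q :
  overlap dlt p q =
  \prod_e if (e \in path_arcs p) && (e \in path_arcs q) then dlt e else 1.
Proof. by rewrite /overlap big_mkcond; apply: eq_bigr => e _; rewrite inE. Qed.

Lemma overlap_ll (a b : ep) (dlt : ep_arc (EPar a b) -> R) p q :
  overlap dlt (inl p) (inl q) = overlap (fun e => dlt (inl e)) p q.
Proof.
rewrite !overlapE big_sumType /= [X in _ * X]big1 ?mulr1; last first.
  by move=> e _; rewrite mem_path_arcs_rl.
by apply: eq_bigr => e _; rewrite !mem_path_arcs_ll.
Qed.

Lemma overlap_rr (a b : ep) (dlt : ep_arc (EPar a b) -> R) p q :
  overlap dlt (inr p) (inr q) = overlap (fun e => dlt (inr e)) p q.
Proof.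
rewrite !overlapE big_sumType /= [X in X * _]big1 ?mul1r; last first.
  by move=> e _; rewrite mem_path_arcs_lr.
by apply: eq_bigr => e _; rewrite !mem_path_arcs_rr.
Qed.

Lemma overlap_lr (a b : ep) (dlt : ep_arc (EPar a b) -> R) p q :
  overlap dlt (inl p) (inr q) = 1.
Proof.
rewrite overlapE big1 // => -[e|e] _; first by rewrite mem_path_arcs_lr andbF.
by rewrite mem_path_arcs_rl.
Qed.

Lemma overlap_rl (a b : ep) (dlt : ep_arc (EPar a b) -> R) p q :
  overlap dlt (inr p) (inl q) = 1.
Proof.
rewrite overlapE big1 // => -[e|e] _; last by rewrite mem_path_arcs_rl andbF.
by rewrite mem_path_arcs_lr.
Qed.

Lemma overlap_ser (a : ep) (dlt : ep_arc (ESer a) -> R) p q :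
  overlap dlt p q = dlt None * overlap (fun e => dlt (Some e)) p q.
Proof.
rewrite !overlapE (bigD1 None) //= !mem_path_arcs_None; congr (_ * _).
rewrite (reindex_omap Some id) /=; last by case.
apply: eq_big => [e|e _]; first by rewrite eqxx.
by rewrite !mem_path_arcs_Some.
Qed.

(** Between parallel branches the kernel is [1], so the cross terms are those of the square and
    induction treats the diagonal blocks; a series arc multiplies the form by a factor in [[0, 1]],
    which the nonnegative square absorbs. *)
Lemma bil_overlap_le (g : ep) (dlt : ep_arc g -> R) (f : ep_path g -> R) :
  (forall e, 0 <= dlt e <= 1) ->
  bil (overlap dlt) f f <= (\sum_p f p) ^+ 2.
Proof.
elim: g dlt f => [|a IHa b IHb|a IHa] dlt f hd.
- have E (F : ep_path EArc -> R) : \sum_p F p = F tt by rewrite (big_pred1 tt) //; case.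
  rewrite /bil !E expr2 -[leRHS]mul1r ler_wpM2r -?expr2 ?sqr_ge0 //.
  suff /andP[] : 0 <= overlap dlt tt tt <= 1 by [].
  apply: (big_ind (fun x : R => 0 <= x <= 1)) => [|x y /andP[x0 x1] /andP[y0 y1]|e _].
  + by rewrite ler01 lexx.
  + by rewrite mulr_ge0 // mulr_ile1.
  + exact: hd.
- rewrite /bil !big_sumType /=.
  set SA := \sum_q f (inl q); set SB := \sum_q f (inr q).
  have -> : \sum_(i : ep_path a) \sum_(j : ep_path a + ep_path b)
      overlap dlt (inl i) j * (f (inl i) * f j) =
      bil (overlap (fun e => dlt (inl e))) (fun q => f (inl q)) (fun q => f (inl q)) + SA * SB.
    rewrite /SA mulr_suml -big_split; apply: eq_bigr => i _ /=.
    rewrite big_sumType /= mulr_sumr; congr (_ + _); apply: eq_bigr => j _.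
      by rewrite overlap_ll.
    by rewrite overlap_lr mul1r.
  have -> : \sum_(i : ep_path b) \sum_(j : ep_path a + ep_path b)
      overlap dlt (inr i) j * (f (inr i) * f j) =
      bil (overlap (fun e => dlt (inr e))) (fun q => f (inr q)) (fun q => f (inr q)) + SB * SA.
    rewrite /SB mulr_suml -big_split; apply: eq_bigr => i _ /=.
    rewrite big_sumType /= mulr_sumr addrC; congr (_ + _); apply: eq_bigr => j _.
      by rewrite overlap_rr.
    by rewrite overlap_rl mul1r.
  have := IHa (fun e => dlt (inl e)) (fun q => f (inl q)) (fun e => hd _).
  have := IHb (fun e => dlt (inr e)) (fun q => f (inr q)) (fun e => hd _).
  rewrite -/SA -/SB; set X := bil _ _ _; set Y := bil _ _ _; rewrite sqrrD; lra.
have -> : bil (overlap dlt) f f = dlt None * bil (overlap (fun e => dlt (Some e))) f f.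
  rewrite /bil mulr_sumr; apply: eq_bigr => p _; rewrite mulr_sumr; apply: eq_bigr => q _.
  by rewrite overlap_ser -mulrA.
have h1 := IHa (fun e => dlt (Some e)) f (fun e => hd _).
have /andP[d0 d1] := hd None.
apply: (@le_trans _ _ (dlt None * (\sum_p f p) ^+ 2)); first exact: ler_wpM2l.
by rewrite -[leRHS]mul1r ler_wpM2r // sqr_ge0.
Qed.
End OverlapKernel.

(** * Gibbs weights: M-convexity and the single positive eigenvalue *)

Section GibbsWeight.
Variables (R : realType) (g : ep) (c : ep_arc g -> nat -> rat) (T : R).
Hypothesis c_mono : forall e k, c e k <= c e k.+1.
Hypothesis T_ge0 : 0 <= T.
Implicit Types al u v : {ffun ep_path g -> nat}.

Definition cost_sum e l : rat := \sum_(1 <= k < l.+1) c e k.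
Definition potential al : rat := \sum_e cost_sum e (arc_load al e).
Definition weight al : R := expR (- T * ratr (potential al)).

Lemma weight_gt0 al : 0 < weight al. Proof. exact: expR_gt0. Qed.

Lemma cost_sumS e l : cost_sum e l.+1 = cost_sum e l + c e l.+1.
Proof. by rewrite /cost_sum big_nat_recr. Qed.

Lemma c_homo e k l : (k <= l)%N -> c e k <= c e l.
Proof. by move=> kl; apply: (@homo_leq _ (c e) <=%R) kl => //; exact: le_trans. Qed.

Lemma arc_load_incr al a e : arc_load (incr al a) e = (arc_load al e + (e \in path_arcs a))%N.
Proof.
rewrite /arc_load (eq_bigr (fun p => (al p + (p == a))%N)); last by move=> p _; rewrite ffunE.
rewrite big_split /=; congr (_ + _)%N.
case: (boolP (e \in path_arcs a)) => h.
  by rewrite (bigD1 a) //= eqxx big1 // => p /andP[_ /negPf ->].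
by rewrite big1 // => p; case: eqP => // -> hp; rewrite hp in h.
Qed.

Lemma arc_load_decr al a e : (0 < al a)%N ->
  (arc_load (decr al a) e + (e \in path_arcs a))%N = arc_load al e.
Proof. by move=> h; rewrite -arc_load_incr decrK. Qed.

(* M-convexity of the potential. *)
Lemma potential_exchange u v a : total u = total v -> (u a < v a)%N ->
  exists2 b, (v b < u b)%N &
    potential (incr (decr u b) a) + potential (incr (decr v a) b) <= potential u + potential v.
Proof.
move=> tuv h.
have [[hs _]|[b [hb H1 H2]]] := exchange_path h; first by move: hs; rewrite -/(total u) tuv ltnn.
exists b => //.
have ub : (0 < u b)%N by apply: leq_ltn_trans hb.
have va : (0 < v a)%N by apply: leq_ltn_trans h.
(* The inequality holds arc by arc: only arcs on exactly one of the paths [a] and [b] change, and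
   there the order of the loads and monotone costs decide. *)
rewrite -!big_split; apply: ler_sum => e _ /=.
rewrite !arc_load_incr -(arc_load_decr e ub) -(arc_load_decr e va).
have := H1 e; have := H2 e; rewrite -(arc_load_decr e ub) -(arc_load_decr e va).
set x := arc_load (decr u b) e; set y := arc_load (decr v a) e.
case: (e \in path_arcs a) => /=; case: (e \in path_arcs b) => //=.
- by move=> _ /(_ isT isT); rewrite !addn1 !addn0 ltnS => xy; rewrite !cost_sumS;
    have := @c_homo e x.+1 y.+1 xy; lra.
- by move=> /(_ isT isT) + _; rewrite !addn1 !addn0 ltnS => xy; rewrite !cost_sumS;
    have := @c_homo e y.+1 x.+1 xy; lra.
Qed.

Lemma weight_exchange u v a : total u = total v -> (u a < v a)%N ->
  exists2 b, (v b < u b)%N &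
    weight u * weight v <= weight (incr (decr u b) a) * weight (incr (decr v a) b).
Proof.
move=> tuv h; have [b hb H] := potential_exchange tuv h; exists b => //.
rewrite /weight -!expRD ler_expR -!mulrDr -!rmorphD /= !mulNr lerN2.
by apply: ler_wpM2l => //; rewrite ler_rat.
Qed.

Lemma potential_incr al a :
  potential (incr al a) = potential al + \sum_(e in path_arcs a) c e (arc_load al e).+1.
Proof.
rewrite [X in _ + X]big_mkcond -big_split; apply: eq_bigr => e _ /=.
rewrite arc_load_incr; case: (e \in _); last by rewrite addn0 addr0.
by rewrite addn1 cost_sumS.
Qed.

(** The mixed second difference of the potential lives on the arcs common to [a] and [b], where it
    is the increment of the marginal cost; exponentiating yields an [overlap] kernel. *)
Lemma weight_incr2 al a b :
  weight (incr (incr al a) b) =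
  weight (incr al a) * weight (incr al b) / weight al *
  overlap (fun e => expR (- T * ratr (c e (arc_load al e).+2 - c e (arc_load al e).+1))) a b.
Proof.
have E : potential (incr (incr al a) b) = potential (incr al a) + potential (incr al b) - potential al
  + \sum_(e in path_arcs a :&: path_arcs b) (c e (arc_load al e).+2 - c e (arc_load al e).+1).
  rewrite 2!(potential_incr _ b) -!addrA; congr (_ + _).
  rewrite (_ : forall x y z : rat, x + (y + (- x + z)) = y + z); last by move=> x y z; ring.
  rewrite [LHS]big_mkcond [X in _ = X + _]big_mkcond [X in _ = _ + X]big_mkcond -big_split.
  apply: eq_bigr => e _ /=; rewrite inE arc_load_incr.
  case: (e \in path_arcs a); case: (e \in path_arcs b) => //=; rewrite ?addn1 ?addn0 ?addr0 //.
  by rewrite subrKC.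
rewrite /overlap -expR_sum /weight -expRN -!expRD E; congr expR.
rewrite -mulr_sumr -rmorph_sum /=; set S := \sum_(e in _) _.
by rewrite !(rmorphD, rmorphN) /=; ring.
Qed.

(** For [m = 0], rescaling [f] turns the form into an overlap form with arc factors in [[0, 1]].
    Each further summed-out ball is one application of [lorentz_sum]. *)
Lemma lorentz_weight m al : lorentz (fun a b => msum m weight (incr (incr al a) b)).
Proof.
elim: m al => [|m IH] al /=; last first.
  apply: (@lorentz_sum R _ (fun x a b => msum m weight (incr (incr (incr al a) b) x))).
  - by move=> x y z; rewrite (incrAC _ z x) (incrAC al y x) (incrAC _ z y).
  - by move=> x y z; rewrite (incrAC al).
  - by move=> x y z; apply: msum_gt0 => // be; exact: weight_gt0.
  - move=> x f; have := IH (incr al x) f; rewrite /bil => h.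
    have E (a b : ep_path g) : msum m weight (incr (incr (incr al a) b) x) =
        msum m weight (incr (incr (incr al x) a) b).
      by rewrite (incrAC _ b x) (incrAC al a x).
    under eq_bigr => a _ do under eq_bigr => b _ do rewrite E.
    under [X in _ * X <= _]eq_bigr => a _ do under eq_bigr => b _ do rewrite E.
    by under [X in _ <= X ^+ 2]eq_bigr => a _ do under eq_bigr => b _ do rewrite E.
have w0 := weight_gt0.
apply: (@lorentz_of_square _ _ _ (fun a => weight (incr al a) / Num.sqrt (weight al))).
- by move=> a b; rewrite incrAC.
- rewrite /bil (bigD1 (some_path g)) //= (bigD1 (some_path g)) //= !mulr1 -addrA.
  apply: ltr_wpDr => //; apply: addr_ge0; apply: sumr_ge0 => i _.
    by rewrite mulr1 ltW.
  by apply: sumr_ge0 => j _; rewrite mulr1 ltW.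
move=> f; set dlt := fun e => expR (- T * ratr (c e (arc_load al e).+2 - c e (arc_load al e).+1)).
have hd e : 0 <= dlt e <= 1.
  rewrite expR_ge0 expR_le1 mulNr oppr_le0 mulr_ge0 // ler0q subr_ge0; exact: c_mono.
apply: le_trans (bil_overlap_le (fun a => weight (incr al a) / Num.sqrt (weight al) * f a) hd).
rewrite le_eqVlt; apply/orP; left; apply/eqP.
apply: eq_bigr => a _; apply: eq_bigr => b _.
rewrite weight_incr2 -/dlt -{1}(sqr_sqrtr (ltW (w0 al))) expr2 invfM; ring.
Qed.
End GibbsWeight.

(** * Resampling dynamics on profiles *)

Lemma ler_sum_inj (R : realType) (I J : finType) (Q : pred I) (Q' : pred J)
    (h : I -> J) (F : J -> R) :
  (forall j, 0 <= F j) -> {in Q &, injective h} -> (forall i, Q i -> Q' (h i)) ->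
  \sum_(i | Q i) F (h i) <= \sum_(j | Q' j) F j.
Proof.
move=> F0 hi hQ.
have -> : \sum_(i | Q i) F (h i) = \sum_(j in h @: [set i | Q i]) F j.
  rewrite big_imset /=; first by apply: eq_bigl => i; rewrite inE.
  by move=> i j; rewrite !inE; exact: hi.
rewrite big_mkcond [leRHS]big_mkcond; apply: ler_sum => j _.
case: imsetP => [[i]|_]; last by case: ifP.
by rewrite inE => /hQ Qi ->; rewrite Qi.
Qed.

Section Profiles.
Variables (R : realType) (P : finType) (n : nat).
Local Notation prof := {ffun 'I_n -> P}.
Implicit Types (s u v : prof) (C : {set 'I_n}) (i j : 'I_n).

Definition loads s : {ffun P -> nat} := [ffun p => #|[set i | s i == p]|].

Definition upd s i a : prof := [ffun j => if j == i then a else s j].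

Lemma loads_gt0 s i : (0 < loads s (s i))%N.
Proof. by rewrite ffunE card_gt0; apply/set0Pn; exists i; rewrite inE. Qed.

Lemma sum_loads s (G : P -> R) : \sum_i G (s i) = \sum_p (loads s p)%:R * G p.
Proof.
rewrite (partition_big s xpredT) //=; apply: eq_bigr => p _.
rewrite (eq_bigr (fun=> G p)); last by move=> i /eqP ->.
by rewrite sumr_const mulr_natl ffunE; congr (_ *+ _); apply: eq_card => i; rewrite !inE.
Qed.

Lemma total_loads s : total (loads s) = n.
Proof.
rewrite /total -[RHS]card_ord -sum1_card (partition_big s xpredT) //=.
apply: eq_bigr => p _; rewrite ffunE sum1dep_card //.
Qed.

Lemma loads_upd s i a : loads (upd s i a) = incr (decr (loads s) (s i)) a.
Proof.
apply/ffunP => p; rewrite !ffunE (cardsD1 i) [in RHS](cardsD1 i) !inE !ffunE eqxx.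
rewrite (eq_sym p (s i)) addKn addnC (eq_sym a); congr (_ + _)%N.
by apply: eq_card => k; rewrite !inE ffunE; case: (k == i).
Qed.

Lemma loads_perm s (t : {perm 'I_n}) : loads [ffun k => s (t k)] = loads s.
Proof.
apply/ffunP => p; rewrite !ffunE.
rewrite -(card_imset _ (@perm_inj _ t)); apply: eq_card => k; rewrite !inE.
apply/imsetP/idP => [[x]|h]; first by rewrite inE ffunE => h ->.
by exists (t^-1%g k); rewrite ?inE ?ffunE permKV.
Qed.

Definition agree C s u := [forall i, (i \notin C) ==> (u i == s i)].

Lemma agreeP C s u : reflect (forall i, i \notin C -> u i = s i) (agree C s u).
Proof.
apply: (iffP forallP) => [h i iC|h i]; last by apply/implyP => /h ->.
by move/implyP: (h i) => /(_ iC) /eqP.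
Qed.

Lemma agree_refl C s : agree C s s. Proof. exact/agreeP. Qed.

Lemma agree_upd s i a : agree [set i] s (upd s i a).
Proof. by apply/agreeP => j; rewrite inE ffunE => /negPf ->. Qed.

Lemma upd_agree s i u : agree [set i] s u -> upd s i (u i) = u.
Proof.
move=> /agreeP h; apply/ffunP => j; rewrite ffunE.
by case: eqP => [->//|/eqP ji]; rewrite h ?inE.
Qed.

Variable phi : {ffun P -> nat} -> R.
Hypothesis phi_gt0 : forall al, 0 < phi al.

(** Numerator of [cexp C f s], the Gibbs expectation of [f] given the choices in [s] of the players
    outside [C]. *)
Definition csum C s (f : prof -> R) := \sum_(u | agree C s u) phi (loads u) * f u.
Definition cexp C f s : R := csum C s f / csum C s (fun=> 1).

Lemma csum1_gt0 C s : 0 < csum C s (fun=> 1).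
Proof.
rewrite /csum (bigD1 s) ?agree_refl //= mulr1; apply: ltr_wpDr => //.
by apply: sumr_ge0 => u _; rewrite mulr1 ltW.
Qed.

Lemma csum_ge0 C s f : (forall u, 0 <= f u) -> 0 <= csum C s f.
Proof. by move=> f0; apply: sumr_ge0 => u _; rewrite mulr_ge0 // ltW. Qed.

Lemma eq_csum C s f f' : f =1 f' -> csum C s f = csum C s f'.
Proof. by move=> h; apply: eq_bigr => u _; rewrite h. Qed.

Lemma eq_cexp C s f f' : f =1 f' -> cexp C f s = cexp C f' s.
Proof. by move=> h; rewrite /cexp (eq_csum _ _ h). Qed.

Lemma cexp_ge0 C s f : (forall u, 0 <= f u) -> 0 <= cexp C f s.
Proof. by move=> f0; apply: divr_ge0; [exact: csum_ge0|exact/ltW/csum1_gt0]. Qed.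

Lemma ler_cexp C s f f' : (forall u, f u <= f' u) -> cexp C f s <= cexp C f' s.
Proof.
move=> h; rewrite /cexp ler_pM2r ?invr_gt0 ?csum1_gt0 //.
by apply: ler_sum => u _; rewrite ler_pM2l.
Qed.

Lemma cexpZ C s c f : cexp C (fun u => c * f u) s = c * cexp C f s.
Proof.
rewrite /cexp mulrA; congr (_ / _); rewrite /csum mulr_sumr.
by apply: eq_bigr => u _; rewrite mulrCA.
Qed.

Lemma cexp_sum C s (I : finType) (f : I -> prof -> R) :
  cexp C (fun u => \sum_i f i u) s = \sum_i cexp C (f i) s.
Proof.
rewrite /cexp -mulr_suml; congr (_ / _); rewrite /csum exchange_big.
by apply: eq_bigr => u _; rewrite mulr_sumr.
Qed.

Lemma cexp1 C s : cexp C (fun=> 1) s = 1.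
Proof. by rewrite /cexp divff // gt_eqF ?csum1_gt0. Qed.

Lemma cexp_set0 f s : cexp set0 f s = f s.
Proof.
have E h : csum set0 s h = phi (loads s) * h s.
  rewrite /csum (big_pred1 s) // => u; apply/agreeP/eqP => [h1|->//].
  by apply/ffunP => i; rewrite h1 ?inE.
by rewrite /cexp !E mulr1 mulrAC divff ?mul1r // gt_eqF.
Qed.

(** [cexp C f] does not depend on the choices of the players in [C]. *)
Lemma cexp_absorb i C f s : i \in C -> cexp [set i] (cexp C f) s = cexp C f s.
Proof.
move=> iC; rewrite /cexp {1}/csum.
rewrite (eq_bigr (fun u => (phi (loads u) * 1) * (csum C s f / csum C s (fun=> 1)))).
  by rewrite -mulr_suml -/(csum [set i] s (fun=> 1)) mulrAC divff ?mul1r // gt_eqF ?csum1_gt0.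
move=> u /agreeP hu; rewrite mulr1; congr (_ * _).
have E h : csum C u h = csum C s h.
  apply: eq_bigl => w; apply/agreeP/agreeP => hw j jC; rewrite hw // hu // inE.
    by apply: contraNneq jC => ->.
  by apply: contraNneq jC => ->.
by rewrite !E.
Qed.

(** * Sequential against joint resampling *)

Hypothesis phi_exchange : forall (u v : {ffun P -> nat}) a, total u = total v -> (u a < v a)%N ->
  exists2 b, (v b < u b)%N & phi u * phi v <= phi (incr (decr u b) a) * phi (incr (decr v a) b).

(** Lifts the exchange of loads to players: the path of [j] in [u] is handed to [i] in [s], while
    [i] takes [s' i] in [u] with [i] and [j] swapped. *)
Lemma profile_exchange i C s s' u : i \notin C -> agree [set i] s s' ->
  agree (i |: C) s u ->
  exists2 j, j \in i |: C &
    phi (loads u) * phi (loads s') <=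
    phi (loads (upd [ffun k => u (tperm i j k)] i (s' i))) * phi (loads (upd s i (u j))).
Proof.
move=> iC hs' /agreeP hu.
set a := s' i.
have EU j : loads (upd [ffun k => u (tperm i j k)] i a) = incr (decr (loads u) (u j)) a.
  by rewrite loads_upd loads_perm ffunE tpermL.
have Es : decr (loads s') a = decr (loads s) (s i).
  by rewrite -(upd_agree hs') loads_upd incrK.
have EV j : loads (upd s i (u j)) = incr (decr (loads s') a) (u j).
  by rewrite loads_upd Es.
have us' k : k \notin i |: C -> u k = s' k.
  move=> kC; rewrite hu //; move/agreeP: hs' => -> //; rewrite inE.
  by apply: contraNneq kC => ->; rewrite setU11.
(* If a redrawn player already uses [a] in [u], the exchange leaves both load vectors unchanged.
   Otherwise [a] is used strictly less in [u] than in [s']. *)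
have [/exists_inP [j jC /eqP uj]|/exists_inPn nj] := boolP [exists j in i |: C, u j == a].
  exists j => //; rewrite EU EV uj !decrK //; first exact: loads_gt0.
  by rewrite -uj; exact: loads_gt0.
have [b hb H] : exists2 b, (loads s' b < loads u b)%N &
    phi (loads u) * phi (loads s') <=
    phi (incr (decr (loads u) b) a) * phi (incr (decr (loads s') a) b).
  apply: phi_exchange; first by rewrite !total_loads.
  rewrite !ffunE; apply/proper_card/properP; split.
    apply/subsetP => k; rewrite !inE => uk; rewrite -us' //.
    by apply: contraL uk => /nj.
  by exists i; rewrite !inE ?eqxx // nj // setU11.
(* Outside [i |: C] both profiles coincide, so the surplus of [u] on [b] must come from a player
   inside. *)
have [/exists_inP [j jC /eqP uj]|/exists_inPn njb] := boolP [exists j in i |: C, u j == b].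
  by exists j => //; rewrite EU EV uj.
move: hb; rewrite ltnNge => /negP []; rewrite !ffunE; apply/subset_leq_card/subsetP => k.
rewrite !inE => uk; rewrite -us' //.
by apply: contraL uk => /njb.
Qed.

(** For fixed [j] the map from [u] to the exchanged pair is injective; the factor [#|C|.+1] counts
    the choices of [j]. *)
Lemma csum_exchange i C s s' : i \notin C -> agree [set i] s s' ->
  phi (loads s') * csum (i |: C) s (fun=> 1) <=
  #|C|.+1%:R * (csum C s' (fun=> 1) * csum [set i] s (fun=> 1)).
Proof.
move=> iC hs'.
pose U u j := upd [ffun k => u (tperm i j k)] i (s' i).
pose V u j := upd s i (u j).
have g0 al : 0 <= phi al by exact: ltW.
apply: (@le_trans _ _ (\sum_(u | agree (i |: C) s u) \sum_(j in i |: C)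
    phi (loads (U u j)) * phi (loads (V u j)))).
  rewrite /csum mulr_sumr; apply: ler_sum => u hu; rewrite mulr1 mulrC.
  have [j jC] := profile_exchange iC hs' hu; move=> /le_trans; apply.
  rewrite (bigD1 j jC) //= lerDl; apply: sumr_ge0 => k _; exact: mulr_ge0.
rewrite exchange_big /=.
have -> : #|C|.+1%:R * (csum C s' (fun=> 1) * csum [set i] s (fun=> 1)) =
   \sum_(j in i |: C) csum C s' (fun=> 1) * csum [set i] s (fun=> 1).
  by rewrite sumr_const cardsU1 iC -[RHS]mulr_natl.
apply: ler_sum => j jC.
have -> : csum C s' (fun=> 1) * csum [set i] s (fun=> 1) =
   \sum_(x : prof * prof | agree C s' x.1 && agree [set i] s x.2) phi (loads x.1) * phi (loads x.2).
  rewrite /csum mulr_suml -(pair_big (fun u => agree C s' u) (fun u => agree [set i] s u)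
     (fun u v => phi (loads u) * phi (loads v))) /=.
  apply: eq_bigr => u _; rewrite mulr_sumr; apply: eq_bigr => v _; by rewrite !mulr1.
apply: (@ler_sum_inj R _ _ _ _ (fun u => (U u j, V u j)) (fun x => phi (loads x.1) * phi (loads x.2))).
- by move=> x; exact: mulr_ge0.
(* Only the value [u j] is overwritten in [U], and [V] records it at [i]. *)
- move=> u v _ _ [hU hV]; apply/ffunP => k.
  have uvj : u j = v j by move/ffunP: hV => /(_ i); rewrite !ffunE eqxx.
  move/ffunP: hU => /(_ (tperm i j k)); rewrite !ffunE tpermK.
  case: eqP => // /(congr1 (tperm i j)); rewrite tpermK tpermL => ->.
  by rewrite uvj.
move=> u /agreeP hu; rewrite agree_upd andbT; apply/agreeP => k kC; rewrite ffunE.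
case: eqP => [->//|/eqP ki]; rewrite ffunE.
have kj : k != j by apply: contraNneq kC => kj; move: jC; rewrite -kj !inE (negPf ki).
rewrite tpermD 1?eq_sym // hu ?inE ?negb_or ?ki //.
by move/agreeP: hs' => -> //; rewrite inE.
Qed.

Lemma csum_partition i C s f : i \notin C ->
  \sum_(s' | agree [set i] s s') csum C s' f = csum (i |: C) s f.
Proof.
move=> iC; rewrite /csum [RHS](partition_big (fun u => upd s i (u i)) (agree [set i] s)) /=; last first.
  by move=> u _; exact: agree_upd.
apply: eq_bigr => s' hs'; apply: eq_bigl => u; apply/agreeP/andP => [h|[/agreeP h /eqP hu] k kC].
  split.
    apply/agreeP => k; rewrite !inE negb_or => /andP[ki kC]; rewrite h //.
    by move/agreeP: hs' => -> //; rewrite inE.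
  by rewrite (h i iC) upd_agree.
rewrite -hu ffunE; case: eqP => [->//|/eqP ki].
by rewrite h // !inE negb_or ki.
Qed.

(** [csum_exchange] bounds the weight of moving to [s'] and then redrawing [C]; [csum_partition]
    sums over [s'] into a joint redraw of [i |: C]. *)
Lemma cexp_dominate i C f s : i \notin C -> (forall u, 0 <= f u) ->
  cexp [set i] (cexp C f) s <= #|C|.+1%:R * cexp (i |: C) f s.
Proof.
move=> iC f0; rewrite {1}/cexp {1}/csum.
rewrite [X in _ <= _ * X]/cexp -(csum_partition s f iC) [leLHS]mulr_suml.
rewrite [X in _ <= _ * X]mulr_suml [leRHS]mulr_sumr.
apply: ler_sum => s' hs'.
have h := csum_exchange iC hs'.
have Z1 := csum1_gt0 (i |: C) s; have Z2 := csum1_gt0 C s'; have Z3 := csum1_gt0 [set i] s.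
rewrite ler_pdivrMr // [_.+1%:R * _]mulrA [leRHS]mulrAC ler_pdivlMr // /cexp.
have -> : phi (loads s') * (csum C s' f / csum C s' (fun=> 1)) * csum (i |: C) s (fun=> 1) =
   csum C s' f / csum C s' (fun=> 1) * (phi (loads s') * csum (i |: C) s (fun=> 1)) by ring.
have c0 : 0 <= csum C s' f / csum C s' (fun=> 1) by apply: divr_ge0; [exact: csum_ge0|exact: ltW].
apply: le_trans (ler_wpM2l c0 h) _.
rewrite le_eqVlt; apply/orP; left; apply/eqP; field; rewrite gt_eqF //.
Qed.

(** Operators act on functions, so the head of [w] is the first player redrawn. *)
Definition run (w : seq 'I_n) (f : prof -> R) : prof -> R :=
  foldr (fun i F => cexp [set i] F) f w.

Lemma run_ge0 w f s : (forall u, 0 <= f u) -> 0 <= run w f s.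
Proof. by move=> f0; elim: w s => [|i w IH] s //=; exact: cexp_ge0. Qed.

Lemma run1 w s : run w (fun=> 1) s = 1.
Proof. by elim: w s => [|i w IH] s //=; rewrite (eq_cexp _ _ IH) cexp1. Qed.

Lemma runZ w c f s : run w (fun u => c * f u) s = c * run w f s.
Proof. by elim: w s => [|i w IH] s //=; rewrite (eq_cexp _ _ IH) cexpZ. Qed.

Lemma run_sum w (I : finType) (f : I -> prof -> R) s :
  run w (fun u => \sum_k f k u) s = \sum_k run w (f k) s.
Proof. by elim: w s => [|i w IH] s //=; rewrite (eq_cexp _ _ IH) cexp_sum. Qed.

Lemma eq_run w f f' s : f =1 f' -> run w f s = run w f' s.
Proof. by move=> h; elim: w s => [|i w IH] s //=; exact: eq_cexp. Qed.

(** A player new to the set [C] of touched players costs a factor [#|C|.+1], a repeated one nothing;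
    the product is the factorial. *)
Lemma run_dominate w f s : (forall u, 0 <= f u) ->
  run w f s <= #|[set i in w]|`!%:R * cexp [set i in w] f s.
Proof.
move=> f0; elim: w s => [|i w IH] s /=.
  have -> : [set i in [::]] = set0 :> {set 'I_n} by apply/setP => j; rewrite !inE.
  by rewrite cards0 fact0 mul1r cexp_set0.
apply: le_trans (ler_cexp _ _ IH) _; rewrite cexpZ.
have -> : [set j in i :: w] = i |: [set j in w] by apply/setP => j; rewrite !inE.
have [iw|iw] := boolP (i \in [set j in w]).
  by rewrite cexp_absorb // (setUidPr _) // sub1set.
rewrite cardsU1 iw add1n factS natrM [X in _ <= X * _]mulrC -mulrA ler_wpM2l //.
exact: cexp_dominate.
Qed.

Lemma cexp_loads (F : {ffun P -> nat} -> R) s i :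
  cexp [set i] (fun u => F (loads u)) s = cond phi F (decr (loads s) (s i)).
Proof.
have E (G : {ffun P -> nat} -> R) : \sum_(u | agree [set i] s u) G (loads u) =
    \sum_a G (incr (decr (loads s) (s i)) a).
  rewrite (reindex_onto (upd s i) (fun u => u i)) /=; last by move=> u; exact: upd_agree.
  apply: eq_big => [a|a _]; first by rewrite agree_upd ffunE eqxx eqxx.
  by rewrite loads_upd.
rewrite /cexp /cond /csum (E (fun al => phi al * F al)) (E (fun al => phi al * 1)).
by congr (_ / _); apply: eq_bigr => a _; rewrite mulr1.
Qed.

(** * Random scan, random words and the covering event *)

Definition glauber (f : prof -> R) : prof -> R :=
  fun s => \sum_i n%:R^-1 * cexp [set i] f s.

Lemma eq_glauber f f' : f =1 f' -> glauber f =1 glauber f'.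
Proof. by move=> h s; apply: eq_bigr => i _; rewrite (eq_cexp _ _ h). Qed.

(** A uniform player is a uniform ball of the load vector. *)
Lemma glauber_loads F s : glauber (fun u => F (loads u)) s = heat_bath phi n F (loads s).
Proof.
rewrite /glauber /heat_bath.
rewrite (eq_bigr (fun i => n%:R^-1 * cond phi F (decr (loads s) (s i)))); last first.
  by move=> i _; rewrite cexp_loads.
rewrite (sum_loads s (fun p => n%:R^-1 * cond phi F (decr (loads s) p))).
by apply: eq_bigr => p _; rewrite mulrA.
Qed.

Lemma iter_glauber_loads t F s :
  iter t glauber (fun u => F (loads u)) s = iter t (heat_bath phi n) F (loads s).
Proof.
elim: t s => [//|t IH] s /=.
by rewrite (eq_glauber IH) glauber_loads.
Qed.

Fixpoint word_avg t (F : seq 'I_n -> R) (w : seq 'I_n) : R :=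
  if t is t'.+1 then \sum_i n%:R^-1 * word_avg t' F (i :: w) else F w.

Lemma eq_word_avg t F G w : F =1 G -> word_avg t F w = word_avg t G w.
Proof. by move=> h; elim: t w => [|t IH] w //=; apply: eq_bigr => i _; rewrite IH. Qed.

Lemma ler_word_avg t F G w : (forall x, F x <= G x) -> word_avg t F w <= word_avg t G w.
Proof.
move=> h; elim: t w => [|t IH] w //=; apply: ler_sum => i _.
by apply: ler_wpM2l; rewrite ?invr_ge0.
Qed.

Lemma word_avgD t F G w : word_avg t (fun x => F x + G x) w = word_avg t F w + word_avg t G w.
Proof.
elim: t w => [//|t IH] w /=; rewrite -big_split; apply: eq_bigr => i _ /=.
by rewrite IH mulrDr.
Qed.

Lemma word_avgZ t c F w : word_avg t (fun x => c * F x) w = c * word_avg t F w.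
Proof.
elim: t w => [//|t IH] w /=; rewrite mulr_sumr; apply: eq_bigr => i _ /=.
by rewrite IH mulrCA.
Qed.

Lemma word_avg_sum t (I : finType) (F : I -> seq 'I_n -> R) w :
  word_avg t (fun x => \sum_k F k x) w = \sum_k word_avg t (F k) w.
Proof.
elim: t w => [//|t IH] w /=; rewrite exchange_big /=; apply: eq_bigr => i _ /=.
by rewrite IH mulr_sumr.
Qed.

Lemma word_avg_const t c w : (0 < n)%N -> word_avg t (fun=> c) w = c.
Proof.
move=> n0; elim: t w => [//|t IH] w /=.
rewrite (eq_bigr (fun=> n%:R^-1 * c)); last by move=> i _; rewrite IH.
by rewrite sumr_const card_ord -mulrnAl -[_ *+ _]mulr_natl divff ?mul1r // pnatr_eq0 -lt0n.
Qed.

Lemma word_avg_notin t i w : (0 < n)%N ->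
  word_avg t (fun x => (i \notin x)%:R) w = (i \notin w)%:R * (1 - n%:R^-1) ^+ t.
Proof.
move=> n0; elim: t w => [|t IH] w /=; first by rewrite mulr1.
rewrite (bigD1 i) //= IH inE eqxx mul0r mulr0 add0r.
rewrite (eq_bigr (fun=> n%:R^-1 * ((i \notin w)%:R * (1 - n%:R^-1) ^+ t))); last first.
  by move=> j ji; rewrite IH inE eq_sym (negPf ji).
rewrite sumr_const cardC1 card_ord -mulrnAl exprS mulrA [_%:R * (1 - _)]mulrC -mulrA; congr (_ * _).
by rewrite -mulr_natl -subn1 natrB // mulrBl mul1r divff // pnatr_eq0 -lt0n.
Qed.

Lemma word_avg_run t f s w :
  word_avg t (fun x => run x f s) w = iter t glauber (run w f) s.
Proof.
elim: t w => [//|t IH] w /=; rewrite (eq_bigr (fun i => n%:R^-1 * iter t glauber (run (i :: w) f) s)); last first.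
  by move=> i _; rewrite IH.
rewrite -[RHS]/(iter t.+1 glauber (run w f) s) iterSr.
have: forall (F : 'I_n -> prof -> R), \sum_i n%:R^-1 * iter t glauber (F i) s =
    iter t glauber (fun u => \sum_i n%:R^-1 * F i u) s.
  move=> F; elim: t s {IH} => [//|t IH] s /=; rewrite -(eq_glauber IH) /glauber.
  under eq_bigr do rewrite mulr_sumr.
  rewrite exchange_big; apply: eq_bigr => j _ /=.
  rewrite cexp_sum mulr_sumr; apply: eq_bigr => i _.
  by rewrite cexpZ.
by move=> /(_ (fun i => run (i :: w) f)) ->.
Qed.

Definition covers (w : seq 'I_n) := [set i in w] == setT.

(** Union bound over the players missed by the word. *)
Lemma word_avg_not_covers t : (0 < n)%N ->
  word_avg t (fun w => (~~ covers w)%:R) [::] <= n%:R * (1 - n%:R^-1) ^+ t.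
Proof.
move=> n0; apply: (@le_trans _ _ (word_avg t (fun w => \sum_i (i \notin w)%:R) [::])).
  apply: ler_word_avg => w; case: (boolP (covers w)) => /= [_|]; first exact: sumr_ge0.
  rewrite /covers eqEsubset subsetT /= => /subsetPn [i _]; rewrite inE => iw.
  by rewrite (bigD1 i) //= iw lerDl sumr_ge0.
rewrite word_avg_sum (eq_bigr (fun=> (1 - n%:R^-1) ^+ t)); last first.
  by move=> i _; rewrite word_avg_notin // mul1r.
by rewrite sumr_const card_ord mulr_natl.
Qed.

Definition pavg (f : prof -> R) : R :=
  (\sum_u phi (loads u) * f u) / \sum_u phi (loads u).

Lemma cexp_setT f s : cexp setT f s = pavg f.
Proof.
rewrite /cexp /csum /pavg.
have E (G : prof -> R) : \sum_(u | agree setT s u) G u = \sum_u G u.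
  by apply: eq_bigl => u; apply/agreeP => i; rewrite inE.
by rewrite !E; congr (_ / _); apply: eq_bigr => u _; rewrite mulr1.
Qed.

(* Expectation of [f] after [t] updates from [s], on the event that every player moved. *)
Definition refreshed t s f : R :=
  word_avg t (fun w => (covers w)%:R * run w f s) [::].

Definition unrefreshed t s f : R :=
  word_avg t (fun w => (~~ covers w)%:R * run w f s) [::].

Lemma refreshedD t s F :
  refreshed t s (fun u => F (loads u)) + unrefreshed t s (fun u => F (loads u)) =
  iter t (heat_bath phi n) F (loads s).
Proof.
rewrite -iter_glauber_loads -(word_avg_run t _ s [::]) /refreshed /unrefreshed -word_avgD.
by apply: eq_word_avg => w; case: covers; rewrite ?mul1r ?mul0r ?addr0 ?add0r.
Qed.

Lemma refreshed_ge0 t s f : (forall u, 0 <= f u) -> 0 <= refreshed t s f.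
Proof.
move=> f0; rewrite /refreshed; have : forall w, 0 <= (covers w)%:R * run w f s.
  by move=> w; rewrite mulr_ge0 // run_ge0.
elim: t [::] => [|t IH] w h //=.
by apply: sumr_ge0 => i _; rewrite mulr_ge0 ?invr_ge0 // IH.
Qed.

Lemma unrefreshed_ge0 t s f : (forall u, 0 <= f u) -> 0 <= unrefreshed t s f.
Proof.
move=> f0; rewrite /unrefreshed; have : forall w, 0 <= (~~ covers w)%:R * run w f s.
  by move=> w; rewrite mulr_ge0 // run_ge0.
elim: t [::] => [|t IH] w h //=.
by apply: sumr_ge0 => i _; rewrite mulr_ge0 ?invr_ge0 // IH.
Qed.

Lemma refreshed_sum t s (I : finType) (f : I -> prof -> R) :
  refreshed t s (fun u => \sum_k f k u) = \sum_k refreshed t s (f k).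
Proof.
rewrite /refreshed -word_avg_sum; apply: eq_word_avg => w.
by rewrite run_sum mulr_sumr.
Qed.

Lemma unrefreshed_sum t s (I : finType) (f : I -> prof -> R) :
  unrefreshed t s (fun u => \sum_k f k u) = \sum_k unrefreshed t s (f k).
Proof.
rewrite /unrefreshed -word_avg_sum; apply: eq_word_avg => w.
by rewrite run_sum mulr_sumr.
Qed.

Lemma refreshedZ t s c f : refreshed t s (fun u => c * f u) = c * refreshed t s f.
Proof.
rewrite /refreshed -word_avgZ; apply: eq_word_avg => w.
by rewrite runZ mulrCA.
Qed.

Lemma eq_refreshed t s f f' : f =1 f' -> refreshed t s f = refreshed t s f'.
Proof. by move=> h; apply: eq_word_avg => w; rewrite (eq_run _ _ h). Qed.

Lemma eq_unrefreshed t s f f' : f =1 f' -> unrefreshed t s f = unrefreshed t s f'.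
Proof. by move=> h; apply: eq_word_avg => w; rewrite (eq_run _ _ h). Qed.

Lemma unrefreshed1 t s : (0 < n)%N ->
  unrefreshed t s (fun=> 1) <= n%:R * (1 - n%:R^-1) ^+ t.
Proof.
move=> n0; apply: le_trans (word_avg_not_covers t n0).
by apply: ler_word_avg => w; rewrite run1 mulr1.
Qed.

Lemma pavg_ge0 f : (forall u, 0 <= f u) -> 0 <= pavg f.
Proof.
move=> f0; apply: divr_ge0; apply: sumr_ge0 => u _; last exact: ltW.
by rewrite mulr_ge0 // ltW.
Qed.

(** On covering words [run_dominate] compares with the joint redraw of all players, which is the
    Gibbs mean; the other words contribute [0]. *)
Lemma refreshed_le t s f : (0 < n)%N -> (forall u, 0 <= f u) ->
  refreshed t s f <= n`!%:R * pavg f.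
Proof.
move=> n0 f0; rewrite -[leRHS](@word_avg_const t _ [::]) //.
apply: ler_word_avg => w; case: (boolP (covers w)) => [/eqP cw|_] /=; last first.
  by rewrite mul0r mulr_ge0 // pavg_ge0.
rewrite mul1r; apply: le_trans (run_dominate w s f0) _.
by rewrite cw cardsT card_ord cexp_setT.
Qed.

End Profiles.

(** * From profiles to load vectors *)

Section Extend.
Variables (P : finType) (n : nat).

Definition extend (a : P) (s : {ffun 'I_n -> P}) : {ffun 'I_n.+1 -> P} :=
  [ffun i => if unlift ord0 i is Some j then s j else a].

Lemma loads_extend a s : loads (extend a s) = incr (loads s) a.
Proof.
apply/ffunP => p; rewrite !ffunE.
have E m (u : {ffun 'I_m -> P}) : #|[set i | u i == p]| = (\sum_i (u i == p))%N.
  by rewrite -sum1_card big_mkcond; apply: eq_bigr => i _; rewrite inE; case: eqP.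
rewrite !E big_ord_recl ffunE unlift_none addnC eq_sym; congr (_ + _)%N.
by apply: eq_bigr => j _; rewrite ffunE liftK.
Qed.

Lemma extend_bij : bijective (fun x : P * {ffun 'I_n -> P} => extend x.1 x.2).
Proof.
exists (fun s : {ffun 'I_n.+1 -> P} => (s ord0, [ffun j : 'I_n => s (lift ord0 j)])).
  move=> [a s]; rewrite /extend ffunE unlift_none; congr (_, _).
  by apply/ffunP => j; rewrite !ffunE liftK.
by move=> s; apply/ffunP => i; rewrite ffunE; case: unliftP => [j ->|->]; rewrite ?ffunE.
Qed.
End Extend.

Lemma loads0 (P : finType) (s : {ffun 'I_0 -> P}) : loads s = [ffun=> 0%N].
Proof. by apply/ffunP => p; rewrite !ffunE; apply: eq_card0 => -[]. Qed.

Lemma loads_surj (P : finType) n (al : {ffun P -> nat}) : total al = n ->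
  exists s : {ffun 'I_n -> P}, loads s = al.
Proof.
elim: n al => [|n IH] al tal.
  have al0 : al = [ffun=> 0%N].
    by apply/ffunP => p; move/eqP: tal; rewrite ffunE sum_nat_eq0 => /forallP /(_ p) /eqP.
  have f (i : 'I_0) : P by case: i.
  by exists [ffun i => f i]; rewrite loads0 al0.
have [a ha] : exists a, (0 < al a)%N.
  apply/existsP; apply: contra_eqT tal => /existsPn h.
  by rewrite /total big1 // => p _; apply/eqP; rewrite -leqn0 leqNgt h.
have [s hs] : exists s : {ffun 'I_n -> P}, loads s = decr al a.
  by apply: IH; apply/succn_inj; rewrite total_decr.
by exists (extend a s); rewrite loads_extend hs decrK.
Qed.

(** Splitting off the first player matches the recursion of [msum]. *)
Lemma sum_profiles_loads (R : realType) (P : finType) n (F : {ffun P -> nat} -> R) :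
  \sum_(s : {ffun 'I_n -> P}) F (loads s) = msum n F [ffun=> 0%N].
Proof.
elim: n F => [|n IH] F.
  rewrite /= (eq_bigr (fun=> F [ffun=> 0%N])); last by move=> s _; rewrite loads0.
  by rewrite sumr_const card_ffun card_ord expn0 mulr1n.
rewrite (reindex _ (onW_bij _ (@extend_bij P n))) /= -[RHS]/(msum n.+1 F [ffun=> 0%N]).
rewrite -msum_incr -IH exchange_big pair_big /=.
by apply: eq_bigr => x _; rewrite loads_extend.
Qed.

(** * Density of the refreshed law *)

Section Density.
Variables (R : realType) (P : finType) (n : nat) (p0 : P).
Local Notation prof := {ffun 'I_n -> P}.
Variable phi : {ffun P -> nat} -> R.
Hypothesis phi_gt0 : forall al, 0 < phi al.
Implicit Types (u v s : prof) (F : {ffun P -> nat} -> R).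

Definition occur (al : {ffun P -> nat}) : nat := #|[set u : prof | loads u == al]|.

Lemma occur_gt0 u : (0 < occur (loads u))%N.
Proof. by rewrite card_gt0; apply/set0Pn; exists u; rewrite inE. Qed.

Lemma sum_occur F u :
  F (loads u) = \sum_(v : prof) F (loads v) / (occur (loads v))%:R * (loads u == loads v)%:R.
Proof.
transitivity (\sum_(v : prof | loads v == loads u) F (loads u) / (occur (loads u))%:R).
  rewrite sumr_const (_ : #|_| = occur (loads u)); last first.
    by apply: eq_card => v; rewrite inE.
  by rewrite -[RHS]mulr_natl mulrC divfK // pnatr_eq0 -lt0n occur_gt0.
rewrite big_mkcond; apply: eq_bigr => v _; rewrite eq_sym.
by case: eqP => [->|_]; rewrite ?mulr1 ?mulr0.
Qed.

Let Z := \sum_(u : prof) phi (loads u).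

Lemma pavg_loads v : pavg phi (fun u => (loads u == loads v)%:R) =
  (occur (loads v))%:R * phi (loads v) / Z.
Proof.
rewrite /pavg; congr (_ / _).
transitivity (\sum_(u : prof | loads u == loads v) phi (loads v)).
  rewrite [RHS]big_mkcond; apply: eq_bigr => u _.
  by case: eqP => [->|_]; rewrite ?mulr1 ?mulr0.
rewrite sumr_const (_ : #|_| = occur (loads v)) ?mulr_natl //.
by apply: eq_card => u; rewrite inE.
Qed.

Lemma partition_gt0 : 0 < Z.
Proof.
rewrite /Z sum_profiles_loads; exact: msum_gt0.
Qed.

Lemma pavg_expect F : pavg phi (fun u : prof => F (loads u)) = expect phi n F / Z.
Proof.
by rewrite /pavg /expect -(sum_profiles_loads n (fun al => phi al * F al)).
Qed.

Hypothesis phi_exchange : forall (u v : {ffun P -> nat}) a, total u = total v -> (u a < v a)%N ->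
  exists2 b, (v b < u b)%N & phi u * phi v <= phi (incr (decr u b) a) * phi (incr (decr v a) b).
Hypothesis n_gt0 : (0 < n)%N.

(** Radon-Nikodym derivative, against the Gibbs law of the loads, of the part of the law due to
    covering words. At loads that no profile realises, division by zero gives [0]. *)
Definition refreshed_density t s (al : {ffun P -> nat}) : R :=
  refreshed phi t s (fun u => (loads u == al)%:R) / pavg phi (fun u : prof => (loads u == al)%:R).

Lemma refreshed_density_ge0 t s al : 0 <= refreshed_density t s al.
Proof.
by apply: divr_ge0; [apply: refreshed_ge0|apply: pavg_ge0].
Qed.

Lemma refreshed_density_le t s al : refreshed_density t s al <= n`!%:R.
Proof.
have := @pavg_ge0 _ _ n _ phi_gt0 (fun u : prof => (loads u == al)%:R) (fun=> ler0n _ _).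
rewrite le_eqVlt /refreshed_density => /orP[/eqP <-|h]; first by rewrite invr0 mulr0.
by rewrite ler_pdivrMr //; apply: refreshed_le.
Qed.

Lemma refreshed_densityE t s F :
  refreshed phi t s (fun u => F (loads u)) =
  pavg phi (fun u : prof => refreshed_density t s (loads u) * F (loads u)).
Proof.
rewrite (eq_refreshed _ _ _ (sum_occur F)) refreshed_sum.
rewrite /pavg mulr_suml; apply: eq_bigr => v _; rewrite refreshedZ /refreshed_density.
rewrite pavg_loads -/Z.
have o0 : (occur (loads v))%:R != 0 :> R by rewrite pnatr_eq0 -lt0n occur_gt0.
have f0 : phi (loads v) != 0 by rewrite gt_eqF.
have Z0 : Z != 0 by rewrite gt_eqF ?partition_gt0.
by field; rewrite o0 f0 Z0.
Qed.

End Density.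

(** * The base-exchange chain *)

Section BaseExchange.
Variables (R : realType) (g : ep) (n : nat) (c : ep_arc g -> nat -> rat) (T : R).
Local Notation P := (ep_path g).
Local Notation W := (weight c T).
Implicit Types (A B : {set E' g n}) (s : profile g n).

Lemma load_arc_load s e : load s e = arc_load (loads s) e.
Proof.
rewrite /load /arc_load -sum1_card (partition_big s xpredT) //= [RHS]big_mkcond.
apply: eq_bigr => p _; rewrite ffunE -sum1_card.
case: ifP => h; last first.
  by rewrite big_pred0 // => i; rewrite inE; case: eqP => [->|]; rewrite ?h ?andbF.
by apply: eq_bigl => i; rewrite !inE; case: eqP => [->|]; rewrite ?h ?andbF.
Qed.

Lemma rosenthal_potential s : rosenthal c s = potential c (loads s).
Proof. by apply: eq_bigr => e _; rewrite load_arc_load. Qed.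

Lemma gibbsE s : gibbs c T s = W (loads s) / \sum_(u : profile g n) W (loads u).
Proof.
rewrite /gibbs /weight rosenthal_potential; congr (_ / _).
by apply: eq_bigr => u _; rewrite rosenthal_potential.
Qed.

Lemma PhiA_potential al : total al = n -> PhiA n c al = potential c al.
Proof.
move=> tal; rewrite /PhiA; case: pickP => [s|/=].
  by rewrite inE rosenthal_potential => /eqP <-.
have [s hs] := loads_surj tal.
by move=> /(_ s); rewrite inE -hs eqxx.
Qed.

Lemma sum_base A (G : P -> R) :
  \sum_(e in A) G e.1 = \sum_p (alphaB A p)%:R * G p.
Proof.
rewrite (partition_big (fun e : E' g n => e.1) xpredT) //=; apply: eq_bigr => p _.
rewrite (eq_bigr (fun=> G p)); last by move=> e /andP[_ /eqP ->].
rewrite sumr_const mulr_natl ffunE; congr (_ *+ _).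
rewrite -(card_imset _ (_ : injective (fun j : 'I_n => (p, j)))); last by move=> i j [].
apply: eq_card => -[q j]; rewrite unfold_in /=; apply/andP/imsetP => [[h /eqP /= E]|[k]].
  by exists j; rewrite ?inE -?E.
by rewrite inE => h [-> ->]; rewrite /= eqxx.
Qed.

Lemma total_alphaB A : total (alphaB A) = #|A|.
Proof.
apply/eqP; rewrite -(eqr_nat R) -sum1_card !natr_sum; apply/eqP.
rewrite (sum_base A (fun=> 1)); apply: eq_bigr => p _; rewrite mulr1 //.
Qed.

Lemma alphaB_setU1 A x : x \notin A -> alphaB (x |: A) = incr (alphaB A) x.1.
Proof.
move=> xA; apply/ffunP => p; rewrite !ffunE; case: x xA => q j xA /=.
case: (p =P q) => [->|pq].
  rewrite (_ : [set _ | _] = j |: [set k | (q, k) \in A]).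
    by rewrite cardsU1 inE xA addnC.
  by apply/setP => k; rewrite !inE xpair_eqE eqxx.
by rewrite addn0; apply: eq_card => k; rewrite !inE xpair_eqE; case: eqP.
Qed.

Lemma alphaB_le A p : (alphaB A p <= n)%N.
Proof. by rewrite ffunE -[leqRHS]card_ord; exact: max_card. Qed.

Lemma sum_notin A (G : P -> R) :
  \sum_(e | e \notin A) G e.1 = \sum_p (n - alphaB A p)%:R * G p.
Proof.
have -> : \sum_(e | e \notin A) G e.1 = \sum_(e in ~: A) G e.1.
  by apply: eq_bigl => e; rewrite inE.
rewrite sum_base; apply: eq_bigr => p _; congr (_%:R * _).
apply/eqP; rewrite -(eqn_add2l (alphaB A p)) subnKC ?alphaB_le // !ffunE.
rewrite -[X in _ == X]card_ord -(cardsC [set j | (p, j) \in A]) eqn_add2l.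
by apply/eqP/eq_card => j; rewrite !inE.
Qed.

Lemma sum_base_superset A (G : {set E' g n} -> R) : #|A|.+1 = n ->
  \sum_(B : {set E' g n} | (A \subset B) && is_base B) G B = \sum_(x | x \notin A) G (x |: A).
Proof.
move=> cA; pose D := [set x | x \notin A].
transitivity (\sum_(x in D) G (x |: A)); last by apply: eq_bigl => x; rewrite inE.
rewrite -(big_imset G (h := fun x => x |: A)) /=; last first.
  move=> x y; rewrite !inE => xA yA /setP /(_ x); rewrite !inE eqxx /= (negPf xA) orbF.
  by move=> /esym /eqP.
apply: eq_bigl => B; apply/andP/imsetP => [[AB /eqP cB]|[x]].
  have /eqP/cards1P [x hx] : #|B :\: A| = 1%N.
    by rewrite cardsD (setIidPr AB) cB -[X in (X - _)%N]cA subSnn.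
  exists x; first by rewrite inE; have : x \in B :\: A by [rewrite hx set11]; rewrite inE => /andP[].
  rewrite -hx; apply/setP => y; rewrite !inE.
  by case: (boolP (y \in A)) => yA; rewrite ?orbF // (subsetP AB).
rewrite inE => xA ->; split; first exact: subsetUr.
by rewrite /is_base cardsU1 xA add1n cA.
Qed.

(** Collects the binomials and factorials of [wPi], as ['C(n, k) * k! = n ^_ k]. *)
Definition base_weight_factor (al : {ffun P -> nat}) : R := \prod_p (n ^_ (al p))%:R.

Lemma wPi_weight B : is_base B ->
  wPi c T B = n`!%:R / base_weight_factor (alphaB B) * W (alphaB B).
Proof.
move=> /eqP cB; rewrite /wPi PhiA_potential ?total_alphaB // -/(weight c T _).
congr (_ * _); rewrite mulrAC mulrC; congr (_ * _).
rewrite -invfM; congr (_^-1).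
rewrite /base_weight_factor !natr_prod -big_split; apply: eq_bigr => p _ /=.
by rewrite -natrM bin_ffact.
Qed.

Lemma base_weight_factor_gt0 (al : {ffun P -> nat}) : (forall p, al p <= n)%N -> 0 < base_weight_factor al.
Proof. by move=> h; apply: prodr_gt0 => p _; rewrite ltr0n ffact_gt0. Qed.

Lemma base_weight_factor_incr al p :
  base_weight_factor (incr al p) = base_weight_factor al * (n - al p)%:R.
Proof.
rewrite /base_weight_factor (bigD1 p) //= [in RHS](bigD1 p) //= !ffunE eqxx addn1.
rewrite ffactnSr natrM mulrAC; congr (_ * _ * _).
by apply: eq_bigr => q /negPf qp; rewrite ffunE qp addn0.
Qed.

(** A path has as many free copies as the factor by which adding one multiplies its falling
    factorial. The two cancel, so the new path is drawn with plain Gibbs weights. *)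
Lemma sum_wPi_superset A (f : {ffun P -> nat} -> R) : #|A|.+1 = n ->
  \sum_(B : {set E' g n} | (A \subset B) && is_base B) wPi c T B * f (alphaB B) =
  n`!%:R / base_weight_factor (alphaB A) *
    \sum_p W (incr (alphaB A) p) * f (incr (alphaB A) p).
Proof.
move=> cA; rewrite sum_base_superset //.
have lt p : (alphaB A p < n)%N.
  rewrite -[ltnRHS]cA ltnS -total_alphaB /total (bigD1 p) //=; exact: leq_addr.
rewrite (eq_bigr (fun x => n`!%:R / (base_weight_factor (alphaB A) * (n - alphaB A x.1)%:R) *
    W (incr (alphaB A) x.1) * f (incr (alphaB A) x.1))); last first.
  move=> x xA; rewrite wPi_weight; last by rewrite /is_base cardsU1 xA add1n cA.
  by rewrite alphaB_setU1 // base_weight_factor_incr.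
rewrite (sum_notin A (fun p => n`!%:R / (base_weight_factor (alphaB A) * (n - alphaB A p)%:R) *
    W (incr (alphaB A) p) * f (incr (alphaB A) p))) mulr_sumr.
apply: eq_bigr => p _.
have k0 : base_weight_factor (alphaB A) != 0.
  by rewrite gt_eqF // base_weight_factor_gt0 // => q; exact: ltnW.
have n0 : (n - alphaB A p)%:R != 0 :> R by rewrite pnatr_eq0 subn_eq0 -ltnNge.
by field; rewrite n0 k0.
Qed.

(** Lumping: a uniform element of [B] is a uniform ball of [alphaB B], and its replacement depends
    on the remaining loads only. *)
Lemma sum_kernel B (f : {ffun P -> nat} -> R) : is_base B ->
  \sum_(B' : {set E' g n}) bx_kernel c T B B' * f (alphaB B') = heat_bath W n f (alphaB B).
Proof.
move=> bB; have /eqP cB := bB.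
under eq_bigr do rewrite /bx_kernel mulr_suml.
rewrite exchange_big /=.
rewrite (eq_bigr (fun e : E' g n => n%:R^-1 * cond W f (decr (alphaB B) e.1))); last first.
  move=> e eB; rewrite cB.
  have cA : #|B :\ e|.+1 = n by apply: etrans cB; rewrite [RHS](cardsD1 e) eB.
  under eq_bigr do rewrite -mulrA.
  rewrite -mulr_sumr; congr (_ * _).
  set D := \sum_(B'' : {set E' g n} | _) wPi c T B''.
  transitivity ((\sum_(B' : {set E' g n} | (B :\ e \subset B') && is_base B') wPi c T B' * f (alphaB B')) / D).
    rewrite mulr_suml [RHS]big_mkcond; apply: eq_bigr => B' _.
    by case: ifP => _; rewrite ?mul0r // mulrAC.
  have -> : D = \sum_(B' : {set E' g n} | (B :\ e \subset B') && is_base B') wPi c T B' * (fun=> 1) (alphaB B').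
    by apply: eq_bigr => B' _; rewrite mulr1.
  rewrite (sum_wPi_superset f cA) (sum_wPi_superset (fun=> 1) cA).
  have E : alphaB B = incr (alphaB (B :\ e)) e.1.
    by rewrite -alphaB_setU1 ?setD1K // !inE eqxx.
  rewrite E incrK /cond.
  have k0 : n`!%:R / base_weight_factor (alphaB (B :\ e)) != 0 :> R.
    rewrite mulf_neq0 ?invr_neq0 ?pnatr_eq0 -?lt0n ?fact_gt0 // gt_eqF //.
    by apply: base_weight_factor_gt0 => q; exact: alphaB_le.
  rewrite invfM mulrACA divff // mul1r; congr (_ / _).
  by apply: eq_bigr => a _; rewrite mulr1.
rewrite (sum_base B (fun p => n%:R^-1 * cond W f (decr (alphaB B) p))).
by apply: eq_bigr => p _; rewrite mulrA.
Qed.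

Lemma bx_dist_base B0 t B : is_base B0 -> ~~ is_base B -> bx_dist c T B0 t B = 0.
Proof.
move=> b0 bB; case: t => [|t] /=.
  by case: eqP => // E; move: bB; rewrite E b0.
rewrite big1 // => A _; rewrite /bx_kernel big1 ?mulr0 // => e _.
by rewrite (negPf bB) andbF mulr0.
Qed.

Lemma bx_dist_heat_bath B0 t (f : {ffun P -> nat} -> R) : is_base B0 ->
  \sum_(B : {set E' g n}) bx_dist c T B0 t B * f (alphaB B) = iter t (heat_bath W n) f (alphaB B0).
Proof.
move=> b0; elim: t f => [|t IH] f.
  rewrite /= (bigD1 B0) //= eqxx mul1r big1 ?addr0 // => B /negPf ->.
  by rewrite mul0r.
rewrite iterSr -IH /=; under eq_bigr do rewrite mulr_suml.
rewrite exchange_big; apply: eq_bigr => B _ /=.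
have [bB|bB] := boolP (is_base B); last first.
  by rewrite big1 ?bx_dist_base ?mul0r // => B' _; rewrite !mul0r.
by rewrite -sum_kernel // mulr_sumr; apply: eq_bigr => B' _; rewrite mulrA.
Qed.

Lemma output_dist_heat_bath B0 t s : is_base B0 ->
  output_dist c T B0 t s =
  iter t (heat_bath W n) (fun al => (loads s == al)%:R / (occur n al)%:R) (alphaB B0).
Proof.
move=> b0; rewrite -bx_dist_heat_bath //; apply: eq_bigr => B _; congr (_ * _).
by rewrite inE; case: eqP => _; rewrite ?mul1r ?mul0r.
Qed.

End BaseExchange.

(** * Total variation and numerical bounds *)

(** Hellinger against entropy: with [y = sqrt x] it is [ln y >= 1 - 1 / y]. *)
Lemma xlnx_sqrt (R : realType) (x : R) : 0 <= x ->
  (Num.sqrt x - 1) ^+ 2 <= x * ln x - x + 1.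
Proof.
rewrite le_eqVlt => /orP[/eqP <-|x0]; first by rewrite sqrtr0 mul0r; lra.
have y0 : 0 < Num.sqrt x by rewrite sqrtr_gt0.
have E : x = Num.sqrt x ^+ 2 by rewrite sqr_sqrtr // ltW.
set y := Num.sqrt x in y0 E *.
have h : 1 - y^-1 <= ln y.
  have := @ln_le_subr1 R y^-1; rewrite invr_gt0 lnV ?posrE // => /(_ y0); lra.
have h2 : x * (2 * (1 - y^-1)) <= x * ln x.
  rewrite ler_pM2l // [in ln x]E lnXn // -mulr_natl; lra.
apply: le_trans (_ : x * (2 * (1 - y^-1)) - x + 1 <= _); last by lra.
have -> : x * (2 * (1 - y^-1)) = 2 * y ^+ 2 - 2 * y by rewrite E; field; rewrite gt_eqF.
by rewrite E sqrrB; lra.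
Qed.

(** A linearised Pinsker bound: [|x - 1| = |y - 1| (y + 1)] with [y = sqrt x], split by the
    arithmetic-geometric inequality with free parameter [l]. *)
Lemma normr_sub1_le (R : realType) (x l : R) : 0 <= x -> 0 < l ->
  `|x - 1| <= l / 2 * (x * ln x - x + 1) + (x + 1) / l.
Proof.
move=> x0 l0; have h := xlnx_sqrt x0.
have E : x = Num.sqrt x ^+ 2 by rewrite sqr_sqrtr.
have y0 := sqrtr_ge0 x.
set y := Num.sqrt x in h E y0.
have h1 : l / 2 * (y - 1) ^+ 2 <= l / 2 * (x * ln x - x + 1).
  by rewrite ler_pM2l // divr_gt0.
have h2 : (y + 1) ^+ 2 / (2 * l) <= (x + 1) / l.
  rewrite ler_pdivrMr ?mulr_gt0 // mulrCA divfK ?gt_eqF // E.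
  by have := sqr_ge0 (y - 1); rewrite sqrrB sqrrD; lra.
apply: le_trans (lerD h1 h2).
have -> : x - 1 = (y - 1) * (y + 1) by rewrite E; ring.
rewrite normrM (ger0_norm (_ : 0 <= y + 1)); last by lra.
rewrite -(real_normK (num_real (y - 1))).
set a := `|y - 1|; set b := y + 1.
rewrite -subr_ge0.
have -> : l / 2 * a ^+ 2 + b ^+ 2 / (2 * l) - a * b = (l * a - b) ^+ 2 / (2 * l).
  by field; rewrite gt_eqF.
by apply: divr_ge0; [exact: sqr_ge0 | rewrite mulr_ge0 // ltW].
Qed.

(** * Iterating the heat bath *)

Section HeatBathIter.
Variables (R : realType) (P : finType) (p0 : P) (n : nat).
Variable phi : {ffun P -> nat} -> R.
Hypothesis phi_gt0 : forall al, 0 < phi al.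
Hypothesis phi_lorentz : forall m al,
  lorentz (fun a b => msum m phi (incr (incr al a) b)).
Implicit Types (f h : {ffun P -> nat} -> R).
Local Notation HB := (heat_bath phi n.+1).
Local Notation Ex := (expect phi n.+1).

Lemma eq_heat_bath h h' : h =1 h' -> HB h =1 HB h'.
Proof.
move=> hh al; apply: eq_bigr => p _; congr (_ * (_ / _)).
by apply: eq_bigr => a _; rewrite hh.
Qed.

Lemma condZ k h be : cond phi (fun al => k * h al) be = k * cond phi h be.
Proof.
rewrite /cond mulrA; congr (_ / _); rewrite mulr_sumr.
by apply: eq_bigr => a _; rewrite mulrCA.
Qed.

Lemma iter_heat_bathZ t k h al : iter t HB (fun be => k * h be) al = k * iter t HB h al.
Proof.
elim: t al => [//|t IH] al; rewrite !iterS (eq_heat_bath IH).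
rewrite [LHS]/heat_bath [in RHS]/heat_bath mulr_sumr; apply: eq_bigr => p _.
by rewrite condZ mulrCA.
Qed.

Lemma iter_heat_bath_ge0 t h al : (forall be, 0 <= h be) -> 0 <= iter t HB h al.
Proof.
by move=> h0; elim: t al => [|t IH] al //=; apply: heat_bath_ge0.
Qed.

Lemma expect_iter_adj t f h :
  Ex (fun al => f al * iter t HB h al) = Ex (fun al => iter t HB f al * h al).
Proof.
elim: t f h => [//|t IH] f h.
by rewrite iterSr IH iterS expect_heat_bath_adj.
Qed.

Lemma expect_iter t h : Ex (iter t HB h) = Ex h.
Proof. by elim: t => [//|t IH]; rewrite iterS expect_heat_bath. Qed.

Lemma entropy_iter t h : (forall al, 0 <= h al) -> Ex h = Ex (fun=> 1) ->
  entropy phi n.+1 (iter t HB h) <= (1 - n.+1%:R^-1) ^+ t * entropy phi n.+1 h.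
Proof.
move=> h0 Eh; elim: t => [|t IH]; first by rewrite mul1r.
rewrite iterS exprS -mulrA.
have q0 : 0 <= 1 - n.+1%:R^-1 :> R by rewrite subr_ge0 invf_le1 ?ler1n ?ltr0n.
apply: le_trans (ler_wpM2l q0 IH).
apply: entropy_heat_bath => //; first by move=> al; exact: iter_heat_bath_ge0.
by rewrite expect_iter.
Qed.

Lemma entropy_le h M : (forall al, 0 <= h al) -> (forall al, h al <= M) -> 0 < M ->
  Ex h = Ex (fun=> 1) -> entropy phi n.+1 h <= ln M * Ex (fun=> 1).
Proof.
move=> h0 hM M0 <-; rewrite -msumZ; apply: ler_msum => al _.
rewrite [leRHS]mulrCA ler_pM2l //.
have [hz|hz|hz] := ltrgt0P (h al); last 2 first.
- by have := h0 al; rewrite leNgt hz.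
- by rewrite hz mul0r mulr0.
by rewrite mulrC ler_pM2r // ler_ln ?posrE.
Qed.

Lemma expect_dist1 h l : (forall al, 0 <= h al) -> 0 < l ->
  Ex h = Ex (fun=> 1) ->
  Ex (fun al => `|h al - 1|) <= l / 2 * entropy phi n.+1 h + 2 / l * Ex (fun=> 1).
Proof.
move=> h0 l0 Eh.
have -> : l / 2 * entropy phi n.+1 h + 2 / l * Ex (fun=> 1) =
    l / 2 * entropy phi n.+1 h + (l^-1 - l / 2) * Ex h + (l / 2 + l^-1) * Ex (fun=> 1).
  by rewrite Eh; field; rewrite gt_eqF.
rewrite -!msumZ -!msumD; apply: ler_msum => al _.
apply: le_trans (_ : phi al * (l / 2 * (h al * ln (h al) - h al + 1) + (h al + 1) / l) <= _).
  by rewrite ler_pM2l // normr_sub1_le.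
by rewrite le_eqVlt; apply/orP; left; apply/eqP; ring.
Qed.
End HeatBathIter.

Lemma ffact_le_expn n m : (n ^_ m <= n ^ m)%N.
Proof.
elim: m => [|m IH]; first by rewrite ffactn0.
by rewrite ffactnSr expnSr leq_mul // leq_subr.
Qed.

(** * Numerical estimates for both phases *)

Section Numeric.
Variable R : realType.

Lemma exp_one_sub_inv_le (n t : nat) (x : R) : (0 < n)%N -> n%:R * x <= t%:R ->
  (1 - n%:R^-1) ^+ t <= expR (- x).
Proof.
move=> n0 h; have n0' : 0 < n%:R :> R by rewrite ltr0n.
apply: (@le_trans _ _ (expR (- n%:R^-1) ^+ t)).
  apply: lerXn2r; rewrite ?nnegrE ?expR_ge0 //.
    by rewrite subr_ge0 invf_le1 // ler1n.
  by have := expR_ge1Dx (- n%:R^-1 : R).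
rewrite -expRM_natl ler_expR mulrN lerN2 ler_pdivlMr //; lra.
Qed.

Lemma ln_fact_le (n : nat) (v : R) : (0 < n)%N -> 2^-1 <= v -> ln (n`!%:R / v) <= n%:R ^+ 2.
Proof.
move=> n0 v2; have v0 : 0 < v by lra.
have n0' : 0 < n%:R :> R by rewrite ltr0n.
apply: (@le_trans _ _ (ln (n%:R ^+ n * 2))).
  rewrite ler_ln ?posrE ?divr_gt0 ?mulr_gt0 ?exprn_gt0 ?ltr0n ?fact_gt0 //.
  apply: ler_pM => //; first by rewrite invr_ge0 ltW.
    by rewrite -natrX ler_nat -ffactnn; exact: ffact_le_expn.
  by rewrite -[leRHS]invrK lef_pV2 ?posrE // invr_gt0.
rewrite lnM ?posrE ?exprn_gt0 // lnXn // -[ln _ *+ n]mulr_natl.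
have h1 := ln_le_subr1 n0'; have h2 := ln_le_subr1 (_ : 0 < 2 :> R).
have : n%:R * ln n%:R <= n%:R * (n%:R - 1) :> R by rewrite ler_pM2l.
have : 1 <= n%:R :> R by rewrite ler1n.
have : ln 2 <= 2 - 1 :> R by apply: h2.
by rewrite expr2; lra.
Qed.

Variables (n t : nat) (eps : R).
Hypotheses (n_gt0 : (0 < n)%N) (eps01 : 0 < eps < 1).
Hypothesis t_large : 14%:R * n%:R * ln (n%:R / eps) <= t%:R.

Let L := ln (n%:R / eps).

Let eps0 : 0 < eps. Proof. by case/andP: eps01. Qed.

Let L_gt0 : 0 < L.
Proof.
apply: ln_gt0; rewrite ltr_pdivlMr // mul1r; apply: (@lt_le_trans _ _ 1).
  by case/andP: eps01.
by rewrite ler1n.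
Qed.

Let expL (k : nat) : expR (- (k%:R * L)) = (eps / n%:R) ^+ k.
Proof.
by rewrite -mulrN expRM_natl expRN lnK ?posrE ?divr_gt0 ?ltr0n // invf_div.
Qed.

Let t_gt0 : (0 < t)%N.
Proof.
rewrite -(ltr_nat R); apply: lt_le_trans t_large.
by rewrite mulr_gt0 // mulr_gt0 // ltr0n.
Qed.

Let t_half : t%:R = (uphalf t)%:R + t./2%:R :> R.
Proof. by rewrite -natrD uphalf_half -addnA addnn odd_double_half. Qed.

Let half_le : t./2%:R <= (uphalf t)%:R :> R /\ (uphalf t)%:R <= t./2%:R + 1 :> R.
Proof.
rewrite uphalf_half natrD; split; first by rewrite lerDr.
by rewrite addrC lerD2l -[leRHS]/(1%:R) ler_nat; case: odd.
Qed.

(** One update puts a single player at equilibrium. The case is separate because [L] may then be too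
    small to pay for rounding; the burn-in has the larger half of [t], positive as soon as [t]
    is. *)
Lemma burn_in_single : n = 1%N -> n%:R * (1 - n%:R^-1) ^+ uphalf t = 0 :> R.
Proof.
move=> ->; rewrite invr1 subrr expr0n -leqn0 leqNgt uphalf_gt0 t_gt0.
exact: mulr0.
Qed.

Lemma burn_in_bound : n%:R * (1 - n%:R^-1) ^+ uphalf t <= eps / 2.
Proof.
case: (ltnP 1 n) => n1; last first.
  rewrite burn_in_single; first by rewrite divr_ge0 // ltW.
  by apply/eqP; rewrite eqn_leq n1.
have n2 : 2 <= n%:R :> R by rewrite (ler_nat _ 2).
(* Exponent [2] leaves [n (eps / n)^2 = eps^2 / n], at most [eps / 2] for [n >= 2]. *)
have h : n%:R * (2%:R * L) <= (uphalf t)%:R.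
  have := t_large; rewrite -/L t_half; have [? ?] := half_le.
  have : 0 < n%:R * L by rewrite mulr_gt0 // ltr0n.
  nra.
apply: le_trans (ler_wpM2l _ (exp_one_sub_inv_le n_gt0 h)) _; first exact: ler0n.
rewrite expL.
have -> : n%:R * (eps / n%:R) ^+ 2 = eps * (eps / n%:R) by field; rewrite pnatr_eq0 -lt0n.
rewrite ler_pM2l // ler_pdivrMr; last lra.
have /andP[? ?] := eps01; lra.
Qed.

Lemma entropy_bound (v : R) : 2^-1 <= v -> (n = 1%N -> v = 1) ->
  (1 - n%:R^-1) ^+ t./2 * ln (n`!%:R / v) <= eps ^+ 2 / 16.
Proof.
move=> v2 v1; case: (ltnP 1 n) => n1; last first.
  have n1' : n = 1%N by apply/eqP; rewrite eqn_leq n1.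
  rewrite (v1 n1') n1' divr1 ln1 mulr0; apply: divr_ge0 => //; exact: sqr_ge0.
have n2 : 2 <= n%:R :> R by rewrite (ler_nat _ 2).
(* This pays for the rounding in [t./2]: out of [7 n L], at least [6 n L] remain. *)
have nL : 1 <= n%:R * L.
  have : 2^-1 <= L.
    have h2 : 2 <= n%:R / eps.
      rewrite ler_pdivlMr //; have /andP[? ?] := eps01; lra.
    have := @ln_le_subr1 R 2^-1; rewrite invr_gt0 => /(_ ltac:(lra)).
    rewrite lnV ?posrE //; have : ln 2 <= L by rewrite ler_ln ?posrE // ; lra.
    lra.
  nra.
have h : n%:R * (6%:R * L) <= t./2%:R.
  have := t_large; rewrite -/L t_half; have [? ?] := half_le.
  lra.
have q0 : 0 <= (1 - n%:R^-1) ^+ t./2 :> R.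
  by apply: exprn_ge0; rewrite subr_ge0 invf_le1 ?ltr0n // ler1n ltnW.
apply: le_trans (ler_wpM2l q0 (ln_fact_le n_gt0 v2)) _.
apply: le_trans (ler_wpM2r (sqr_ge0 _) (exp_one_sub_inv_le n_gt0 h)) _.
rewrite expL.
(* Two of the six powers of [n] absorb the bound on the initial entropy; the other four give
   [1/16]. *)
have -> : (eps / n%:R) ^+ 6 * n%:R ^+ 2 = eps ^+ 2 * (eps ^+ 4 / n%:R ^+ 4).
  by field; rewrite pnatr_eq0 -lt0n.
rewrite ler_pM2l ?exprn_gt0 // ler_pdivrMr ?exprn_gt0 ?ltr0n //.
have e4 : eps ^+ 4 <= 1 by apply: exprn_ile1; have /andP[? ?] := eps01; lra.
have : 2 ^+ 4 <= n%:R ^+ 4 :> R by apply: lerXn2r; rewrite ?nnegrE.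
lra.
Qed.
End Numeric.

(** * Total variation distance of the output *)

Section TotalVariation.
Variables (R : realType) (g : ep) (n : nat) (c : ep_arc g -> nat -> rat) (T : R).
Hypothesis c_mono : forall e k, c e k <= c e k.+1.
Hypothesis T_ge0 : 0 <= T.
Variable B0 : {set E' g n.+1}.
Hypothesis B0_base : is_base B0.
Variables (t1 t2 : nat).
Local Notation P := (ep_path g).
Local Notation N := n.+1.
Local Notation W := (weight c T).
Local Notation prof := {ffun 'I_N -> P}.
Local Notation Z := (\sum_(u : prof) W (loads u)).
Let p0 := some_path g.
Let W0 : forall al, 0 < W al := weight_gt0 c T.
Let Wx := weight_exchange c_mono T_ge0.
Let WL := lorentz_weight c_mono T_ge0.

Variable s0 : prof.
Hypothesis s0_loads : loads s0 = alphaB B0.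

(** Probability that the final uniform draw returns [s] when the loads are [al]. *)
Let e (s : prof) (al : {ffun P -> nat}) : R := (loads s == al)%:R / (occur N al)%:R.
Let h0 := refreshed_density W t1 s0.
Let rho := unrefreshed W t1 s0 (fun=> 1).

Let Z0 : 0 < Z. Proof. exact: partition_gt0. Qed.

Let sum_e (u : prof) : \sum_s e s (loads u) = 1.
Proof.
rewrite [RHS](sum_occur (fun=> 1) u); apply: eq_bigr => s _; rewrite /e eq_sym.
by case: eqP => [->|_]; rewrite ?mul0r ?mulr0 // mulr1.
Qed.

Let rho_ge0 : 0 <= rho.
Proof. exact: unrefreshed_ge0. Qed.

Let iterHB_word t F (u : prof) :
  iter t (heat_bath W N) F (loads u) =
  word_avg t (fun w => run W w (fun x : prof => F (loads x)) u) [::].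
Proof. by rewrite word_avg_run iter_glauber_loads. Qed.

Let iterHB1 t (u : prof) : iter t (heat_bath W N) (fun=> 1) (loads u) = 1.
Proof.
rewrite iterHB_word (@eq_word_avg _ _ _ _ (fun=> 1)) ?word_avg_const // => w.
by rewrite run1.
Qed.

Let mass : pavg W (fun u : prof => h0 (loads u)) = 1 - rho.
Proof.
have := refreshedD W t1 s0 (fun=> 1); rewrite iterHB1 -/rho => <-.
rewrite addrK (refreshed_densityE p0 W0 _ _ (fun=> 1)); congr (_ / _).
by apply: eq_bigr => u _; rewrite mulr1.
Qed.

(** The first [t1] steps are split by covering words. On the covering part reversibility moves the
    other [t2] steps from the test function onto the density [h0]. *)
Let output_split s : output_dist c T B0 (t1 + t2) s =
  gibbs c T s * iter t2 (heat_bath W N) h0 (loads s) +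
  unrefreshed W t1 s0 (fun u => iter t2 (heat_bath W N) (e s) (loads u)).
Proof.
rewrite output_dist_heat_bath // iterD -s0_loads -/(e s) -refreshedD; congr (_ + _).
have E (F : {ffun P -> nat} -> R) : pavg W (fun u : prof => F (loads u)) = expect W N F / Z.
  exact: pavg_expect.
rewrite (refreshed_densityE p0 W0) -/h0.
rewrite (E (fun al => h0 al * iter t2 (heat_bath W N) (e s) al)) (expect_iter_adj p0 n W0).
rewrite -(E (fun al => iter t2 (heat_bath W N) h0 al * e s al)) gibbsE /pavg mulrAC.
congr (_ / _).
rewrite (sum_occur (fun al => W al * iter t2 (heat_bath W N) h0 al) s).
by apply: eq_bigr => u _; rewrite /e; ring.
Qed.

Let unrefreshed_mass :
  \sum_s unrefreshed W t1 s0 (fun u => iter t2 (heat_bath W N) (e s) (loads u)) = rho.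
Proof.
rewrite -unrefreshed_sum; apply: eq_unrefreshed => u.
under eq_bigr do rewrite iterHB_word.
rewrite -word_avg_sum (@eq_word_avg _ _ _ _ (fun=> 1)) ?word_avg_const // => w.
by rewrite -run_sum (eq_run _ _ _ sum_e) run1.
Qed.

(** [h0] is rescaled to mass [1], its entropy decays for [t2] steps and is converted into a
    distance. The mass [rho] counts twice: as missing from the refreshed part and as present
    elsewhere. *)
Lemma dTV_output_le (l : R) : 0 < l -> rho < 1 ->
  dTV (output_dist c T B0 (t1 + t2)) (gibbs c T) <=
  2^-1 * (l / 2 * ((1 - N%:R^-1) ^+ t2 * ln (N`!%:R / (1 - rho))) + 2 / l + 2 * rho).
Proof.
move=> l0 rho1; rewrite /dTV; apply: ler_wpM2l; first by rewrite invr_ge0.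
set v := 1 - rho; have v0 : 0 < v by rewrite subr_gt0.
pose k := iter t2 (heat_bath W N) (fun al => v^-1 * h0 al).
have h0E al : iter t2 (heat_bath W N) h0 al = v * k al.
  by rewrite /k iter_heat_bathZ mulVKf ?gt_eqF.
have hn0 al : 0 <= v^-1 * h0 al.
  by rewrite mulr_ge0 ?invr_ge0 ?(ltW v0) // refreshed_density_ge0.
have hnE : expect W N (fun al => v^-1 * h0 al) = expect W N (fun=> 1).
  have E (F : {ffun P -> nat} -> R) : expect W N F = pavg W (fun u : prof => F (loads u)) * Z.
    by rewrite pavg_expect divfK // gt_eqF.
  rewrite !E; congr (_ * _).
  transitivity (v^-1 * pavg W (fun u : prof => h0 (loads u))).
    rewrite /pavg mulrA; congr (_ / _); rewrite mulr_sumr.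
    by apply: eq_bigr => u _; rewrite mulrCA.
  rewrite mass -/v mulVf ?gt_eqF // /pavg -[LHS](divff (lt0r_neq0 Z0)); congr (_ / _).
  by apply: eq_bigr => u _; rewrite mulr1.
have k0 al : 0 <= k al by exact: iter_heat_bath_ge0.
have kE : expect W N k = expect W N (fun=> 1) by rewrite expect_iter.
have ZE : expect W N (fun=> 1) = Z.
  rewrite /expect -(sum_profiles_loads N (fun al => W al * 1)).
  by apply: eq_bigr => u _; rewrite mulr1.
have kent : entropy W N k <= (1 - N%:R^-1) ^+ t2 * ln (N`!%:R / v) * Z.
  apply: le_trans (entropy_iter p0 W0 WL _ hn0 hnE) _.
  rewrite -mulrA; apply: ler_wpM2l.
    by apply: exprn_ge0; rewrite subr_ge0 invf_le1 // ler1n.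
  rewrite -ZE; apply: entropy_le => // [al|]; last by rewrite divr_gt0 // ltr0n fact_gt0.
  by rewrite mulrC ler_pM2r ?invr_gt0 //; exact: refreshed_density_le.
have step s : `|output_dist c T B0 (t1 + t2) s - gibbs c T s| <=
   gibbs c T s * `|k (loads s) - 1| + gibbs c T s * rho +
   unrefreshed W t1 s0 (fun u => iter t2 (heat_bath W N) (e s) (loads u)).
  rewrite output_split h0E.
  set r := unrefreshed _ _ _ _.
  have r0 : 0 <= r.
    apply: unrefreshed_ge0 => // u; apply: iter_heat_bath_ge0 => // be.
    by rewrite /e divr_ge0.
  have g0 : 0 <= gibbs c T s by rewrite gibbsE divr_ge0 // ltW.
  have -> : gibbs c T s * (v * k (loads s)) + r - gibbs c T s =
     gibbs c T s * (v * (k (loads s) - 1)) - gibbs c T s * rho + r by rewrite /v; ring.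
  move: (gibbs c T s) g0 => G g0.
  apply: le_trans (ler_normD _ _) _; rewrite (ger0_norm r0) lerD2r.
  apply: le_trans (ler_normB _ _) _; rewrite !normrM (ger0_norm g0) (ger0_norm rho_ge0) lerD2r.
  rewrite (ger0_norm (ltW v0)); apply: ler_wpM2l => //.
  by rewrite ler_piMl // /v lerBlDr lerDl.
apply: le_trans (ler_sum _ (fun s _ => step s)) _.
rewrite !big_split /= unrefreshed_mass -mulr_suml.
have -> : \sum_(s : profile g N) gibbs c T s = 1.
  rewrite (eq_bigr _ (fun s _ => gibbsE c T s)) -mulr_suml divff // lt0r_neq0 //.
have h : \sum_(s : profile g N) gibbs c T s * `|k (loads s) - 1| <=
    l / 2 * ((1 - N%:R^-1) ^+ t2 * ln (N`!%:R / v)) + 2 / l.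
  have -> : \sum_(s : profile g N) gibbs c T s * `|k (loads s) - 1| =
      expect W N (fun al => `|k al - 1|) / Z.
    rewrite /expect -(sum_profiles_loads N (fun al => W al * `|k al - 1|)) mulr_suml.
    by apply: eq_bigr => s _; rewrite gibbsE mulrAC.
  rewrite ler_pdivrMr // mulrDl -{2}ZE.
  apply: le_trans (expect_dist1 W0 k0 l0 kE) _; rewrite lerD2r -[leRHS]mulrA.
  by apply: ler_wpM2l => //; rewrite divr_ge0 // ltW.
by rewrite mul1r; lra.
Qed.
End TotalVariation.

(** * Burn-in for half of the steps, entropy decay for the rest *)

Theorem mainTheorem4 :
  exists C : rat, 0 < C /\
  forall (R : realType) (g : ep) (n : nat) (c : ep_arc g -> nat -> rat)
         (T eps : R) (B0 : {set E' g n}) (t : nat),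
    (0 < n)%N ->
    (forall e k, 0 <= c e k) ->
    (forall e k, c e k <= c e k.+1) ->
    0 <= T ->
    0 < eps < 1 ->
    is_base B0 ->
    ratr C * n%:R * ln (n%:R / eps) <= t%:R ->
    dTV (output_dist c T B0 t) (gibbs c T) <= eps.
Proof.
(* [14 = 2 (6 + 1)]: two halves, exponent [6] for the entropy phase, one unit for rounding. *)
exists 14%:R; split=> // R g [//|n] c T eps B0 t _ _ c_mono T0 eps01 B0_base.
rewrite ratr_nat => ht.
have [s0 hs0] : exists s0 : {ffun 'I_n.+1 -> ep_path g}, loads s0 = alphaB B0.
  by apply: loads_surj; rewrite (total_alphaB R); apply/eqP.
have /andP[eps0 eps1] := eps01.
have tE : t = (uphalf t + t./2)%N.
  by rewrite uphalf_half -addnA addnn odd_double_half.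
pose rho := unrefreshed (weight c T) (uphalf t) s0 (fun=> 1).
have rho0 : 0 <= rho by apply: unrefreshed_ge0 => // al; exact: weight_gt0.
have hrho := unrefreshed1 (weight_gt0 c T) (uphalf t) s0 (ltn0Sn n).
have rho_eps : rho <= eps / 2 := le_trans hrho (burn_in_bound (ltn0Sn n) eps01 ht).
have v2 : 2^-1 <= 1 - rho by lra.
have v1 : n.+1 = 1%N -> 1 - rho = 1.
  move=> n1; suff -> : rho = 0 by rewrite subr0.
  apply/le_anti; rewrite rho0 andbT; apply: le_trans hrho _.
  by rewrite (burn_in_single (ltn0Sn n) eps01 ht n1).
have hent := entropy_bound (ltn0Sn n) eps01 ht v2 v1.
(* With [l = 8 / eps] the entropy term and [2 / l] are each at most [eps / 4]; adding [2 rho <= eps]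
   and halving gives [3 eps / 4]. *)
have l0 : 0 < 8 / eps by rewrite divr_gt0.
rewrite tE; apply: le_trans (dTV_output_le c_mono T0 B0_base _ hs0 l0 _) _; first by rewrite -/rho; lra.
rewrite -/rho.
have h1 : 8 / eps / 2 * ((1 - n.+1%:R^-1) ^+ t./2 * ln (n.+1`!%:R / (1 - rho))) <= eps / 4.
  apply: le_trans (ler_wpM2l _ hent) _; first by rewrite divr_ge0 // ltW.
  by rewrite le_eqVlt; apply/orP; left; apply/eqP; field; rewrite gt_eqF.
have h2 : 2 / (8 / eps) = eps / 4 by field; rewrite gt_eqF.
lra.
Qed.
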